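(* Let $\mathcal{Q}$ be a Descartes configuration in $\mathbb{R}^2$ whose four curvatures are integers with greatest common divisor $1$. Then there exists a Descartes configuration $\mathcal{Q}'$ in $\mathbb{R}^2$ with the same four curvatures such that, in the Apollonian packing generated by $\mathcal{Q}'$: (1) every disk $A$ of the packing has integral symbol, i.e. $\dot x_A,\dot y_A,A,A^c\in\mathbb{Z}$; (2) for every pair of tangent disks $A,B$ of the packing, the tangency spinor $\mathrm{spin}(A,B)=m+ni$ is a Gaussian integer ($m,n\in\mathbb{Z}$); (3) for every disk $A$ of the packing, the space-time coordinates $z=(A-A^c)/2$ and $t=(A+A^c)/2$ are integers (equivalently $A\equiv A^c \pmod 2$).
   Context: A (generalized) disk in $\mathbb{R}^2$ is one of: (i) a closed round disk of radius $r>0$ with center $(x,y)$, with curvature $A=1/r$; (ii) the closure of the complement of an open round disk of radius $r>0$ with center $(x,y)$, with curvature $A=-1/r$; (iii) a closed half-plane $\{p\in\mathbb{R}^2: p\cdot n\ge h\}$ with $n$ a unit vector and $h\in\mathbb{R}$, with curvature $A=0$. A disk and its curvature are denoted by the same letter. The symbol of a disk $A$ is the quadruple $(\dot x_A,\dot y_A,A,A^c)$, where in cases (i),(ii) the reduced coordinates are $\dot x_A=Ax$, $\dot y_A=Ay$ and the co-curvature is $A^c=(\dot x_A^2+\dot y_A^2-1)/A$ (this equals the curvature of the image of the disk under inversion in the unit circle), and in case (iii) $(\dot x_A,\dot y_A)=n$ and $A^c=2h$. Two disks are tangent if their interiors are disjoint and their boundaries meet in exactly one point, or they are two half-planes with disjoint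 interiors and parallel boundary lines. For tangent disks $A,B$ the tangency spinor $\mathrm{spin}(A,B)\in\mathbb{C}$ is defined up to sign by $\mathrm{spin}(A,B)^2=(A\dot x_B-B\dot x_A)+i\,(A\dot y_B-B\dot y_A)$ (for two round disks with centers $c_A,c_B\in\mathbb{C}$ and signed radii $r_A=1/A$, $r_B=1/B$ this is $\pm\sqrt{(c_B-c_A)/(r_Ar_B)}$). A Descartes configuration is a set of four pairwise tangent generalized disks with pairwise disjoint interiors. Given three of its disks, there are exactly two disks tangent to all three with interiors disjoint from them; the one not in the configuration is the Descartes conjugate of the fourth. The Apollonian packing generated by a Descartes configuration is the collection of all disks appearing in Descartes configurations obtained from it by finitely many replacements of a disk by its Descartes conjugate. *)

(* Defs.v *)
From Stdlib Require Import Reals ZArith.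
Open Scope R_scope.

Definition point := (R * R)%type.

(* Generalized disks:
   - Round c r : closed round disk, center c, radius r > 0
   - Compl c r : closure of the complement of the open disk of center c, radius r > 0
   - Half n h  : closed half-plane { p | p . n >= h }, n a unit vector. *)
Inductive disk : Type :=
| Round : point -> R -> disk
| Compl : point -> R -> disk
| Half  : point -> R -> disk.

Definition wf_disk (D : disk) : Prop :=
  match D with
  | Round _ r => 0 < r
  | Compl _ r => 0 < r
  | Half n h => fst n ^ 2 + snd n ^ 2 = 1
  end.

Definition sqdist (p q : point) : R :=
  (fst p - fst q) ^ 2 + (snd p - snd q) ^ 2.

Definition dot (p q : point) : R := fst p * fst q + snd p * snd q.

Definition in_disk (D : disk) (p : point) : Prop :=
  match D with
  | Round c r => sqdist p c <= r ^ 2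
  | Compl c r => r ^ 2 <= sqdist p c
  | Half n h => h <= dot p n
  end.

Definition in_interior (D : disk) (p : point) : Prop :=
  match D with
  | Round c r => sqdist p c < r ^ 2
  | Compl c r => r ^ 2 < sqdist p c
  | Half n h => h < dot p n
  end.

Definition in_boundary (D : disk) (p : point) : Prop :=
  match D with
  | Round c r => sqdist p c = r ^ 2
  | Compl c r => sqdist p c = r ^ 2
  | Half n h => dot p n = h
  end.

Definition is_halfplane (D : disk) : Prop :=
  match D with Half _ _ => True | _ => False end.

Definition interiors_disjoint (A B : disk) : Prop :=
  forall p, ~ (in_interior A p /\ in_interior B p).

Definition parallel_boundaries (A B : disk) : Prop :=
  match A, B with
  | Half n1 _, Half n2 _ => fst n1 * snd n2 - snd n1 * fst n2 = 0
  | _, _ => False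
  end.

Definition tangent (A B : disk) : Prop :=
  (interiors_disjoint A B /\
     exists! p : point, in_boundary A p /\ in_boundary B p)
  \/ (is_halfplane A /\ is_halfplane B /\ interiors_disjoint A B
      /\ parallel_boundaries A B).

Definition curv (D : disk) : R :=
  match D with
  | Round _ r => 1 / r
  | Compl _ r => - (1 / r)
  | Half _ _ => 0
  end.

Definition xdot (D : disk) : R :=
  match D with
  | Round c r => (1 / r) * fst c
  | Compl c r => (- (1 / r)) * fst c
  | Half n _ => fst n
  end.

Definition ydot (D : disk) : R :=
  match D with
  | Round c r => (1 / r) * snd c
  | Compl c r => (- (1 / r)) * snd c
  | Half n _ => snd n
  end.

Definition cocurv (D : disk) : R :=
  match D with
  | Half _ h => 2 * h
  | _ => (xdot D ^ 2 + ydot D ^ 2 - 1) / curv D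
  end.

Definition is_int (x : R) : Prop := exists z : Z, x = IZR z.

Definition integral_symbol (D : disk) : Prop :=
  is_int (xdot D) /\ is_int (ydot D) /\ is_int (curv D) /\ is_int (cocurv D).

(* spin(A,B)^2 = (A xdot_B - B xdot_A) + i (A ydot_B - B ydot_A); the spinor
   (defined up to sign) is a Gaussian integer m + n i iff (m + n i)^2 equals
   this complex number for some integers m, n. *)
Definition spin_gaussian (A B : disk) : Prop :=
  exists m n : Z,
    IZR m ^ 2 - IZR n ^ 2 = curv A * xdot B - curv B * xdot A /\
    2 * IZR m * IZR n = curv A * ydot B - curv B * ydot A.

(* A configuration of four disks, indexed by 0,1,2,3. *)
Definition config := nat -> disk.

Definition descartes (Q : config) : Prop :=
  (forall i, (i < 4)%nat -> wf_disk (Q i)) /\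
  (forall i j, (i < 4)%nat -> (j < 4)%nat -> i <> j ->
     interiors_disjoint (Q i) (Q j) /\ tangent (Q i) (Q j)).

Definition replace (Q : config) (i : nat) (D : disk) : config :=
  fun j => if Nat.eqb j i then D else Q j.

Definition descartes_conjugate (Q : config) (i : nat) (D : disk) : Prop :=
  wf_disk D /\ D <> Q i /\
  forall j, (j < 4)%nat -> j <> i ->
    interiors_disjoint D (Q j) /\ tangent D (Q j).

Inductive reachable (Q0 : config) : config -> Prop :=
| reach_refl : reachable Q0 Q0
| reach_step : forall Q i D, reachable Q0 Q -> (i < 4)%nat ->
    descartes_conjugate Q i D -> reachable Q0 (replace Q i D).

Definition in_packing (Q0 : config) (D : disk) : Prop :=
  exists Q i, reachable Q0 Q /\ (i < 4)%nat /\ D = Q i.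

(* Main.v *)
Require Import Defs.
From Stdlib Require Import Reals ZArith Lra Lia FunctionalExtensionality.
Open Scope R_scope.

(** The symbol of a disk is a unit vector for a Lorentzian form of signature (3,1), and tangent disks
    have product -1. A Descartes configuration is thus a basis with Gram matrix [2 - J], [J] the
    all-one matrix; inverting it yields Descartes' circle theorem and shows that conjugation replaces
    [V i] by twice the sum of the three others minus [V i]. Conjugation preserves integrality and
    parity of symbols, and it preserves Gaussian spinors because the spinors [b], [c], [d] of a disk
    with the three others satisfy [b ± c ± d = 0] for some choice of signs.

    Two tangent disks [A], [B] of the packing lie in a common configuration: along a reduced word of
    conjugations starting at a configuration containing [B], each new disk has [- form _ B] at least
    the sum of the three other values, hence at least 3, so it is never tangent to [B].

    For the existence of the starting configuration, the circle theorem says that the matrix with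
    diagonal [a0 + a2], [a0 + a1] and off-diagonal entry [(a3 - a0 - a1 - a2) / 2 + a0 i] has
    determinant 0. Euclid's algorithm in Z[i] writes it as [k w w'] with [w] unimodular; [k] divides
    all curvatures, so [k = 1], and the entries of [w] together with their Bezout coefficients are
    the spinors from which the four symbols are built. *)

(** * The Lorentzian form *)

Record vec := Vec { vx : R; vy : R; va : R; vc : R }.

(** Polarization of [x ^ 2 + y ^ 2 - a * c]; with [a = t + z] and [c = t - z] the quadratic form is
    [x ^ 2 + y ^ 2 + z ^ 2 - t ^ 2]. *)
Definition form (u v : vec) : R :=
  vx u * vx v + vy u * vy v - (va u * vc v + vc u * va v) / 2.

Definition sum4 (f : nat -> R) : R := f 0%nat + f 1%nat + f 2%nat + f 3%nat.

Definition gram (V : nat -> vec) : Prop :=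
  forall i j, (i < 4)%nat -> (j < 4)%nat ->
    form (V i) (V j) = if Nat.eqb i j then 1 else -1.

Definition det3 (a b c d e f g h i : R) : R :=
  a * (e * i - f * h) - b * (d * i - f * g) + c * (d * h - e * g).

Definition det4 (r0 r1 r2 r3 : vec) : R :=
  vx r0 * det3 (vy r1) (va r1) (vc r1) (vy r2) (va r2) (vc r2) (vy r3) (va r3) (vc r3)
  - vy r0 * det3 (vx r1) (va r1) (vc r1) (vx r2) (va r2) (vc r2) (vx r3) (va r3) (vc r3)
  + va r0 * det3 (vx r1) (vy r1) (vc r1) (vx r2) (vy r2) (vc r2) (vx r3) (vy r3) (vc r3)
  - vc r0 * det3 (vx r1) (vy r1) (va r1) (vx r2) (vy r2) (va r2) (vx r3) (vy r3) (va r3).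

(** The Gram matrix is [M F M^T] with [F] the matrix of the form, and [det F = -1/4]. *)
Lemma det4_gram (r0 r1 r2 r3 : vec) :
  det4 r0 r1 r2 r3 ^ 2 = -4 *
  det4 (Vec (form r0 r0) (form r0 r1) (form r0 r2) (form r0 r3))
       (Vec (form r1 r0) (form r1 r1) (form r1 r2) (form r1 r3))
       (Vec (form r2 r0) (form r2 r1) (form r2 r2) (form r2 r3))
       (Vec (form r3 r0) (form r3 r1) (form r3 r2) (form r3 r3)).
Proof.
  destruct r0, r1, r2, r3.
  unfold det4, det3, form; simpl vx; simpl vy; simpl va; simpl vc.
  field.
Qed.

(** Cramer's rule: combining the four equations with cofactors isolates the determinant times one
    coordinate of [y]. *)
Lemma det4_kernel (r0 r1 r2 r3 y : vec) :
  det4 r0 r1 r2 r3 <> 0 ->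
  form r0 y = 0 -> form r1 y = 0 -> form r2 y = 0 -> form r3 y = 0 ->
  vx y = 0 /\ vy y = 0 /\ va y = 0 /\ vc y = 0.
Proof.
  intros Hd H0 H1 H2 H3.
  assert (E : forall t : R, det4 r0 r1 r2 r3 * t = 0 -> t = 0)
    by (intros t Ht; apply Rmult_integral in Ht; tauto).
  set (cmb := fun a b c d => a * form r0 y + b * form r1 y + c * form r2 y + d * form r3 y).
  assert (Z : forall a b c d, cmb a b c d = 0)
    by (intros; unfold cmb; rewrite H0, H1, H2, H3; ring).
  clear H0 H1 H2 H3 Hd.
  destruct r0 as [x0 y0 a0 c0], r1 as [x1 y1 a1 c1], r2 as [x2 y2 a2 c2],
    r3 as [x3 y3 a3 c3], y as [x z a c].
  repeat split; apply E.
  - rewrite <- (Z (det3 y1 a1 c1 y2 a2 c2 y3 a3 c3) (- det3 y0 a0 c0 y2 a2 c2 y3 a3 c3)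
      (det3 y0 a0 c0 y1 a1 c1 y3 a3 c3) (- det3 y0 a0 c0 y1 a1 c1 y2 a2 c2)).
    unfold cmb, det4, det3, form; simpl. field.
  - rewrite <- (Z (- det3 x1 a1 c1 x2 a2 c2 x3 a3 c3) (det3 x0 a0 c0 x2 a2 c2 x3 a3 c3)
      (- det3 x0 a0 c0 x1 a1 c1 x3 a3 c3) (det3 x0 a0 c0 x1 a1 c1 x2 a2 c2)).
    unfold cmb, det4, det3, form; simpl. field.
  (* The form pairs [va] with [vc] with weight -1/2: the minors for [va y] omit the [vc] column,
     those for [vc y] the [va] column, and the factors 2 cancel the halves. *)
  - rewrite <- (Z (2 * det3 x1 y1 a1 x2 y2 a2 x3 y3 a3) (- 2 * det3 x0 y0 a0 x2 y2 a2 x3 y3 a3)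
      (2 * det3 x0 y0 a0 x1 y1 a1 x3 y3 a3) (- 2 * det3 x0 y0 a0 x1 y1 a1 x2 y2 a2)).
    unfold cmb, det4, det3, form; simpl. field.
  - rewrite <- (Z (-2 * det3 x1 y1 c1 x2 y2 c2 x3 y3 c3) (2 * det3 x0 y0 c0 x2 y2 c2 x3 y3 c3)
      (-2 * det3 x0 y0 c0 x1 y1 c1 x3 y3 c3) (2 * det3 x0 y0 c0 x1 y1 c1 x2 y2 c2)).
    unfold cmb, det4, det3, form; simpl. field.
Qed.

Lemma lt4_cases (i : nat) : (i < 4)%nat -> i = 0%nat \/ i = 1%nat \/ i = 2%nat \/ i = 3%nat.
Proof. lia. Qed.

Ltac case4 i H := destruct (lt4_cases i H) as [-> | [-> | [-> | ->]]].

(** Names the two remaining indices, so that later sums split without a case analysis on [i] and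
    [j]. *)
Lemma sum4_complete (i j : nat) :
  (i < 4)%nat -> (j < 4)%nat -> i <> j ->
  exists k l, (k < 4)%nat /\ (l < 4)%nat /\ k <> i /\ k <> j /\ l <> i /\ l <> j /\ k <> l /\
    forall f, sum4 f = f i + f j + f k + f l.
Proof.
  intros Hi Hj Hij.
  assert (H : exists k l, (k < 4 /\ l < 4 /\ k <> i /\ k <> j /\ l <> i /\ l <> j /\ k <> l)%nat).
  { case4 i Hi; case4 j Hj; try lia;
      solve [exists 0%nat, 1%nat; lia | exists 0%nat, 2%nat; lia | exists 0%nat, 3%nat; lia
            | exists 1%nat, 2%nat; lia | exists 1%nat, 3%nat; lia | exists 2%nat, 3%nat; lia]. }
  destruct H as (k & l & Hk & Hl & H). exists k, l. repeat split; try tauto.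
  intros f. unfold sum4.
  case4 i Hi; case4 j Hj; try lia; case4 k Hk; try lia; case4 l Hl; try lia; ring.
Qed.

Lemma form_sym (u v : vec) : form u v = form v u.
Proof. unfold form; field. Qed.

Definition comb (c : nat -> R) (V : nat -> vec) : vec :=
  Vec (sum4 (fun i => c i * vx (V i))) (sum4 (fun i => c i * vy (V i)))
      (sum4 (fun i => c i * va (V i))) (sum4 (fun i => c i * vc (V i))).

Lemma form_comb (c : nat -> R) (V : nat -> vec) (Y : vec) :
  form (comb c V) Y = sum4 (fun i => c i * form (V i) Y).
Proof. unfold form, comb, sum4; simpl; field. Qed.

(** [2 - J] has eigenvalues 2, 2, 2, -2, hence determinant -16, and the squared determinant is
    64. *)
Lemma gram_det4 (V : nat -> vec) :
  gram V -> det4 (V 0%nat) (V 1%nat) (V 2%nat) (V 3%nat) <> 0.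
Proof.
  intros G E.
  pose proof (det4_gram (V 0%nat) (V 1%nat) (V 2%nat) (V 3%nat)) as H.
  rewrite E in H. rewrite !G in H by lia.
  unfold det4, det3 in H; simpl in H. lra.
Qed.

(* The Gram matrix is [2 - J] with [J] the all-one matrix; its inverse is [1/2 - J/4]. *)
Lemma gram_expansion (V : nat -> vec) (X : vec) :
  gram V ->
  X = comb (fun i => form X (V i) / 2 - sum4 (fun k => form X (V k)) / 4) V.
Proof.
  intros G.
  set (c := fun i => form X (V i) / 2 - sum4 (fun k => form X (V k)) / 4).
  set (Y := Vec (vx X - vx (comb c V)) (vy X - vy (comb c V))
                (va X - va (comb c V)) (vc X - vc (comb c V))).
  assert (L : forall Z, form Z Y = form X Z - form (comb c V) Z)
    by (intros Z; unfold form, Y; simpl vx; simpl vy; simpl va; simpl vc; field).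
  destruct (det4_kernel (V 0%nat) (V 1%nat) (V 2%nat) (V 3%nat) Y (gram_det4 V G))
    as (H1 & H2 & H3 & H4);
    try (rewrite L, form_comb; unfold c, sum4; rewrite !G by lia; simpl; field).
  unfold Y in *; cbn [vx vy va vc] in *.
  destruct X, (comb c V); cbn [vx vy va vc] in *. f_equal; lra.
Qed.

(** The inverse Gram matrix expresses the form through the products with the [V i]. Suitable [X] and
    [Y] turn this into quadratic relations among curvatures and among squared spinors. *)
Lemma gram_parseval (V : nat -> vec) (X Y : vec) :
  gram V ->
  form X Y = sum4 (fun i => form X (V i) * form Y (V i)) / 2
             - sum4 (fun i => form X (V i)) * sum4 (fun i => form Y (V i)) / 4.
Proof.
  intros G. rewrite (gram_expansion V X G) at 1. rewrite form_comb.
  unfold sum4. rewrite !(form_sym (V _) Y). field.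
Qed.

(** The sum includes [V i] itself, so the coefficient -3 leaves twice the three others minus
    [V i]. *)
Definition move (i : nat) (V : nat -> vec) : nat -> vec := fun j =>
  if Nat.eqb j i then
    Vec (2 * sum4 (fun k => vx (V k)) - 3 * vx (V i)) (2 * sum4 (fun k => vy (V k)) - 3 * vy (V i))
        (2 * sum4 (fun k => va (V k)) - 3 * va (V i)) (2 * sum4 (fun k => vc (V k)) - 3 * vc (V i))
  else V j.

Lemma move_other (i j : nat) (V : nat -> vec) : j <> i -> move i V j = V j.
Proof. intros H. unfold move. apply Nat.eqb_neq in H. now rewrite H. Qed.

Lemma form_move (i : nat) (V : nat -> vec) (X : vec) :
  form (move i V i) X = 2 * sum4 (fun k => form (V k) X) - 3 * form (V i) X.
Proof. unfold move. rewrite Nat.eqb_refl. unfold form, sum4; simpl; field. Qed.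

Lemma move_involutive (i : nat) (V : nat -> vec) : (i < 4)%nat -> move i (move i V) = V.
Proof.
  intros Hi. apply functional_extensionality; intros j.
  destruct (Nat.eq_dec j i) as [-> | N]; [|now rewrite !move_other].
  unfold move, sum4. rewrite Nat.eqb_refl.
  case4 i Hi; simpl; destruct (V 0%nat), (V 1%nat), (V 2%nat), (V 3%nat); simpl; f_equal; ring.
Qed.

Lemma gram_sum (V : nat -> vec) (j : nat) :
  gram V -> (j < 4)%nat -> sum4 (fun k => form (V k) (V j)) = -2.
Proof. intros G Hj. unfold sum4. rewrite !G by lia. case4 j Hj; simpl; ring. Qed.

Lemma gram_move (V : nat -> vec) (i : nat) : gram V -> (i < 4)%nat -> gram (move i V).
Proof.
  intros G Hi.
  (* The values are [2 * (-2) - 3 = -7] at [V i] and [2 * (-2) + 3 = -1] elsewhere. *)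
  assert (H : forall j, (j < 4)%nat -> form (move i V i) (V j) = if Nat.eqb i j then -7 else -1).
  { intros j Hj. rewrite form_move, gram_sum, G by assumption.
    destruct (Nat.eqb i j); ring. }
  intros j k Hj Hk.
  destruct (Nat.eq_dec j i) as [-> | Nj], (Nat.eq_dec k i) as [-> | Nk].
  - rewrite Nat.eqb_refl, form_move. unfold sum4. rewrite !(form_sym (V _)), !H by lia.
    case4 i Hi; simpl; ring.
  - rewrite (move_other i k), H by assumption. rewrite <- (Nat.eqb_sym k i).
    apply Nat.eqb_neq in Nk. now rewrite Nk.
  - rewrite (move_other i j), form_sym, H by assumption. rewrite (Nat.eqb_sym i j).
    apply Nat.eqb_neq in Nj. now rewrite Nj.
  - rewrite !move_other by assumption. now apply G.
Qed.

(* Norm and products fix [form X (V i)] up to the two roots [1] and [-7] of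
   [t ^ 2 + 6 t - 7], and [gram_expansion] recovers [X] from them. *)
Lemma conjugate_symbol (V : nat -> vec) (i : nat) (X : vec) :
  gram V -> (i < 4)%nat -> form X X = 1 ->
  (forall j, (j < 4)%nat -> j <> i -> form X (V j) = -1) ->
  X = V i \/ X = move i V i.
Proof.
  intros G Hi N H.
  pose proof (gram_parseval V X X G) as P.
  pose proof (gram_expansion V X G) as E.
  assert (Hp : form X (V i) = 1 \/ form X (V i) = -7).
  { rewrite N in P. unfold sum4 in P.
    assert (Q : (form X (V i) - 1) * (form X (V i) + 7) = 0).
    { case4 i Hi; repeat rewrite (H 0%nat) in P by lia; repeat rewrite (H 1%nat) in P by lia;
        repeat rewrite (H 2%nat) in P by lia; repeat rewrite (H 3%nat) in P by lia; lra. }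
    apply Rmult_integral in Q. destruct Q; [left | right]; lra. }
  destruct Hp as [Hp | Hp]; [left | right]; rewrite E at 1;
    unfold comb, move, sum4; rewrite ?Nat.eqb_refl;
    case4 i Hi; repeat rewrite Hp; repeat rewrite (H 0%nat) by lia; repeat rewrite (H 1%nat) by lia;
        repeat rewrite (H 2%nat) by lia; repeat rewrite (H 3%nat) by lia; try (f_equal; field);
    destruct (V 0%nat), (V 1%nat), (V 2%nat), (V 3%nat); cbn [vx vy va vc]; f_equal; field.
Qed.

(** * Integrality and Gaussian spinors *)

(** The integers [z], [t] are the space-time coordinates, so integrality of the symbol and the
    parity condition are carried together. *)
Definition lattice (v : vec) : Prop := exists x y z t : Z,
  v = Vec (IZR x) (IZR y) (IZR t + IZR z) (IZR t - IZR z).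

Lemma lattice_move (V : nat -> vec) (i : nat) :
  (forall j, (j < 4)%nat -> lattice (V j)) -> (i < 4)%nat -> lattice (move i V i).
Proof.
  intros L Hi.
  destruct (L 0%nat) as (x0 & y0 & z0 & t0 & E0); [lia|].
  destruct (L 1%nat) as (x1 & y1 & z1 & t1 & E1); [lia|].
  destruct (L 2%nat) as (x2 & y2 & z2 & t2 & E2); [lia|].
  destruct (L 3%nat) as (x3 & y3 & z3 & t3 & E3); [lia|].
  destruct (L i Hi) as (x & y & z & t & E).
  exists (2 * (x0 + x1 + x2 + x3) - 3 * x)%Z, (2 * (y0 + y1 + y2 + y3) - 3 * y)%Z,
    (2 * (z0 + z1 + z2 + z3) - 3 * z)%Z, (2 * (t0 + t1 + t2 + t3) - 3 * t)%Z.
  unfold move, sum4. rewrite Nat.eqb_refl, E, E0, E1, E2, E3.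
  rewrite !minus_IZR, !mult_IZR, !plus_IZR. cbn [vx vy va vc]. f_equal; ring.
Qed.

Definition spin_re (u v : vec) : R := va u * vx v - va v * vx u.
Definition spin_im (u v : vec) : R := va u * vy v - va v * vy u.

Definition gauss_spin (u v : vec) : Prop := exists m n : Z,
  IZR m ^ 2 - IZR n ^ 2 = spin_re u v /\ 2 * IZR m * IZR n = spin_im u v.

(** Exchanging the vectors negates the squared spinor, so the spinor is multiplied by [i]. *)
Lemma gauss_spin_sym (u v : vec) : gauss_spin u v -> gauss_spin v u.
Proof.
  intros (m & n & H1 & H2). exists (- n)%Z, m. rewrite opp_IZR.
  unfold spin_re, spin_im in *. split; lra.
Qed.

Lemma sum_sq_zero (s t : R) : s ^ 2 + t ^ 2 = 0 -> s = 0 /\ t = 0.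
Proof. intros; split; nra. Qed.

(* The squares [wk = pk + qk i] of [b], [c], [d] in C satisfy, by hypothesis,
   [w1^2 + w2^2 + w3^2 = 2 (w1 w2 + w2 w3 + w3 w1)], which factors as the product of the
   four sums [b ± c ± d]. *)
Lemma complex_heron (b1 b2 c1 c2 d1 d2 : R) :
  let p1 := b1 ^ 2 - b2 ^ 2 in let q1 := 2 * b1 * b2 in
  let p2 := c1 ^ 2 - c2 ^ 2 in let q2 := 2 * c1 * c2 in
  let p3 := d1 ^ 2 - d2 ^ 2 in let q3 := 2 * d1 * d2 in
  (p1 ^ 2 + p2 ^ 2 + p3 ^ 2) / 2 - (p1 + p2 + p3) ^ 2 / 4
    = (q1 ^ 2 + q2 ^ 2 + q3 ^ 2) / 2 - (q1 + q2 + q3) ^ 2 / 4 ->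
  (p1 * q1 + p2 * q2 + p3 * q3) / 2 - (p1 + p2 + p3) * (q1 + q2 + q3) / 4 = 0 ->
  (b1 + c1 + d1 = 0 /\ b2 + c2 + d2 = 0) \/ (b1 + c1 - d1 = 0 /\ b2 + c2 - d2 = 0) \/
  (b1 - c1 + d1 = 0 /\ b2 - c2 + d2 = 0) \/ (b1 - c1 - d1 = 0 /\ b2 - c2 - d2 = 0).
Proof.
  intros p1 q1 p2 q2 p3 q3 HR HI.
  assert (P : ((b1 + c1 + d1) ^ 2 + (b2 + c2 + d2) ^ 2) *
              (((b1 + c1 - d1) ^ 2 + (b2 + c2 - d2) ^ 2) *
              (((b1 - c1 + d1) ^ 2 + (b2 - c2 + d2) ^ 2) *
               ((b1 - c1 - d1) ^ 2 + (b2 - c2 - d2) ^ 2))) = 0).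
  { transitivity
      ((4 * ((p1 ^ 2 + p2 ^ 2 + p3 ^ 2) / 2 - (p1 + p2 + p3) ^ 2 / 4
             - ((q1 ^ 2 + q2 ^ 2 + q3 ^ 2) / 2 - (q1 + q2 + q3) ^ 2 / 4))) ^ 2
       + (8 * ((p1 * q1 + p2 * q2 + p3 * q3) / 2
               - (p1 + p2 + p3) * (q1 + q2 + q3) / 4)) ^ 2).
    - unfold p1, q1, p2, q2, p3, q3. field.
    - rewrite HR, HI. ring. }
  apply Rmult_integral in P as [P | P]; [left; now apply sum_sq_zero |].
  apply Rmult_integral in P as [P | P]; [right; left; now apply sum_sq_zero |].
  apply Rmult_integral in P as [P | P]; right; right; [left | right]; now apply sum_sq_zero.
Qed.

Lemma gauss_spin_move (V : nat -> vec) (i j : nat) :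
  gram V -> (i < 4)%nat -> (j < 4)%nat -> j <> i ->
  (forall k, (k < 4)%nat -> k <> j -> gauss_spin (V j) (V k)) ->
  gauss_spin (V j) (move i V i).
Proof.
  intros G Hi Hj Hij S.
  destruct (sum4_complete i j Hi Hj ltac:(auto))
    as (k & l & Hk & Hl & Nki & Nkj & Nli & Nlj & Nkl & Hsum).
  (* [X] and [Y] represent the linear functionals [spin_re (V j)] and [spin_im (V j)]. They are
     orthogonal of equal norm, which Parseval turns into the two hypotheses of [complex_heron]. *)
  set (X := Vec (va (V j)) 0 0 (2 * vx (V j))).
  set (Y := Vec 0 (va (V j)) 0 (2 * vy (V j))).
  assert (HX : forall v, form X v = spin_re (V j) v)
    by (intros v; unfold form, X, spin_re; simpl; field).
  assert (HY : forall v, form Y v = spin_im (V j) v)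
    by (intros v; unfold form, Y, spin_im; simpl; field).
  assert (Xj : spin_re (V j) (V j) = 0) by (unfold spin_re; ring).
  assert (Yj : spin_im (V j) (V j) = 0) by (unfold spin_im; ring).
  assert (Mre : spin_re (V j) (move i V i)
     = 2 * spin_re (V j) (V k) + 2 * spin_re (V j) (V l) - spin_re (V j) (V i)).
  { rewrite <- HX, form_sym, form_move, Hsum, !(form_sym _ X), !HX, Xj. ring. }
  assert (Mim : spin_im (V j) (move i V i)
     = 2 * spin_im (V j) (V k) + 2 * spin_im (V j) (V l) - spin_im (V j) (V i)).
  { rewrite <- HY, form_sym, form_move, Hsum, !(form_sym _ Y), !HY, Yj. ring. }
  assert (PXX : form X X = va (V j) ^ 2) by (unfold form, X; simpl; field).
  assert (PYY : form Y Y = va (V j) ^ 2) by (unfold form, Y; simpl; field).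
  assert (PXY : form X Y = 0) by (unfold form, X, Y; simpl; field).
  rewrite (gram_parseval V X X G) in PXX. rewrite (gram_parseval V Y Y G) in PYY.
  rewrite (gram_parseval V X Y G) in PXY.
  rewrite !Hsum, !HX, !HY in *. rewrite Xj in *. rewrite Yj in *.
  destruct (S k Hk Nkj) as (b1 & b2 & Eb & Eb').
  destruct (S l Hl Nlj) as (c1 & c2 & Ec & Ec').
  destruct (S i Hi ltac:(auto)) as (d1 & d2 & Ed & Ed').
  rewrite <- Eb, <- Ec, <- Ed in *. rewrite <- Eb', <- Ec', <- Ed' in *.
  unfold gauss_spin. rewrite Mre, Mim.
  pose proof (complex_heron (IZR b1) (IZR b2) (IZR c1) (IZR c2) (IZR d1) (IZR d2)) as F.
  cbv zeta in F.
  destruct F as [[F1 F2] | [[F1 F2] | [[F1 F2] | [F1 F2]]]]; try lra.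
  (* The squared new spinor is [2 b^2 + 2 c^2 - d^2], which equals [(b - c)^2] if [d = ± (b + c)]
     and [(b + c)^2] if [d = ± (b - c)]. *)
  - exists (b1 - c1)%Z, (b2 - c2)%Z. rewrite !minus_IZR.
    replace (IZR d1) with (- (IZR b1 + IZR c1)) by lra.
    replace (IZR d2) with (- (IZR b2 + IZR c2)) by lra. split; ring.
  - exists (b1 - c1)%Z, (b2 - c2)%Z. rewrite !minus_IZR.
    replace (IZR d1) with (IZR b1 + IZR c1) by lra.
    replace (IZR d2) with (IZR b2 + IZR c2) by lra. split; ring.
  - exists (b1 + c1)%Z, (b2 + c2)%Z. rewrite !plus_IZR.
    replace (IZR d1) with (IZR c1 - IZR b1) by lra.
    replace (IZR d2) with (IZR c2 - IZR b2) by lra. split; ring.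
  - exists (b1 + c1)%Z, (b2 + c2)%Z. rewrite !plus_IZR.
    replace (IZR d1) with (IZR b1 - IZR c1) by lra.
    replace (IZR d2) with (IZR b2 - IZR c2) by lra. split; ring.
Qed.

Definition gaussian_config (V : nat -> vec) : Prop :=
  gram V /\ (forall i, (i < 4)%nat -> lattice (V i)) /\
  (forall i j, (i < 4)%nat -> (j < 4)%nat -> i <> j -> gauss_spin (V i) (V j)).

Lemma gaussian_config_move (V : nat -> vec) (i : nat) :
  (i < 4)%nat -> gaussian_config V -> gaussian_config (move i V).
Proof.
  intros Hi (G & L & S). split; [now apply gram_move | split].
  - intros j Hj. destruct (Nat.eq_dec j i) as [-> | N]; [now apply lattice_move |].
    rewrite move_other by assumption. auto.
  - intros j k Hj Hk N.
    destruct (Nat.eq_dec j i) as [-> | Nj], (Nat.eq_dec k i) as [-> | Nk].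
    + now destruct N.
    + rewrite (move_other i k) by assumption. apply gauss_spin_sym, gauss_spin_move; auto.
    + rewrite (move_other i j) by assumption. apply gauss_spin_move; auto.
    + rewrite !move_other by assumption. auto.
Qed.

(** * The orbit of a configuration *)

Inductive orbit (V : nat -> vec) : (nat -> vec) -> Prop :=
| orbit_refl : orbit V V
| orbit_move : forall W i, orbit V W -> (i < 4)%nat -> orbit V (move i W).

Lemma orbit_trans (U V W : nat -> vec) : orbit U V -> orbit V W -> orbit U W.
Proof. intros HU HV. induction HV; [assumption | now constructor]. Qed.

Lemma orbit_sym (V W : nat -> vec) : orbit V W -> orbit W V.
Proof.
  intros H. induction H as [| W i _ IH Hi]; [constructor |].
  apply orbit_trans with W; [| assumption].
  rewrite <- (move_involutive i W Hi) at 2. constructor; [constructor | assumption].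
Qed.

Lemma gaussian_config_orbit (V W : nat -> vec) :
  gaussian_config V -> orbit V W -> gaussian_config W.
Proof. intros H O. induction O; auto using gaussian_config_move. Qed.

(* Configurations reached by reduced words of moves from configurations that contain [B].
   Every non-backtracking step produces a disk whose separation [- form _ B] is at least the sum
   of those of the three others, so a disk tangent to [B] is never created by such a step. *)
Inductive tree (B : vec) : (nat -> vec) -> Prop :=
| tree_root : forall V j, gaussian_config V -> (j < 4)%nat -> V j = B -> tree B V
| tree_node : forall V i, tree B V -> (i < 4)%nat ->
    (forall k, (k < 4)%nat -> k <> i -> 1 <= - form (V k) B) ->
    - form (move i V i) B >= - sum4 (fun k => form (V k) B) + form (V i) B ->
    tree B (move i V).

(** At a root, moving a disk other than [B] gives a root again and moving [B] starts a word; later,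
    repeating the last index backtracks and any other index prolongs the word. *)
Lemma tree_move (B : vec) (V : nat -> vec) (i : nat) :
  tree B V -> (i < 4)%nat -> tree B (move i V).
Proof.
  intros T Hi. destruct T as [V j GV Hj E | V j T Hj Hk Hd].
  - destruct (Nat.eq_dec j i) as [-> | N].
    + assert (F : forall k, (k < 4)%nat -> k <> i -> form (V k) B = -1).
      { intros k Hk Nk. rewrite <- E, (proj1 GV) by assumption.
        apply Nat.eqb_neq in Nk. now rewrite Nk. }
      assert (Fi : form (V i) B = 1)
        by (rewrite <- E, (proj1 GV), Nat.eqb_refl by assumption; reflexivity).
      assert (Fs : sum4 (fun k => form (V k) B) = -2)
        by (rewrite <- E; apply gram_sum; [apply GV | assumption]).
      apply tree_node; [apply tree_root with i; assumption | assumption | |].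
      * intros k Hk Nk. rewrite F by assumption. lra.
      (* The separation of the new disk is 7, against the required 3. *)
      * rewrite form_move, Fs, Fi. lra.
    + apply tree_root with j; [now apply gaussian_config_move | assumption |].
      now rewrite move_other.
  - destruct (Nat.eq_dec j i) as [-> | N]; [now rewrite move_involutive |].
    destruct (sum4_complete i j Hi Hj ltac:(auto))
      as (k & l & Hk' & Hl & Nki & Nkj & Nli & Nlj & Nkl & Hsum).
    pose proof (Hk i Hi ltac:(auto)) as Qi.
    pose proof (Hk k Hk' Nkj) as Qk. pose proof (Hk l Hl Nlj) as Ql.
    assert (T' : tree B (move j V)) by (apply tree_node; assumption).
    rewrite Hsum in Hd.
    apply tree_node; [exact T' | assumption | |].
    + intros m Hm Nm. destruct (Nat.eq_dec m j) as [-> | Nmj]; [lra |].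
      rewrite move_other by assumption. auto.
    (* With [q] the current separations, the new one is [2 (q_j + q_k + q_l) - q_i]; the bound
       [q_j >= q_i + q_k + q_l] from the previous move makes it at least [q_j + q_k + q_l]. *)
    + rewrite form_move, Hsum, (move_other j i), (move_other j k), (move_other j l) by auto. lra.
Qed.

Lemma tree_orbit (B : vec) (V W : nat -> vec) : tree B V -> orbit V W -> tree B W.
Proof. intros T O. induction O; auto using tree_move. Qed.

Lemma tree_spin (B : vec) (V : nat -> vec) (k : nat) :
  tree B V -> (k < 4)%nat -> form (V k) B = -1 -> gauss_spin (V k) B.
Proof.
  intros T. induction T as [V j GV Hj E | V i T IH Hi Hq Hd]; intros Hk F.
  - destruct GV as (G & _ & S). rewrite <- E in *. apply S; try assumption.
    intros ->. rewrite G, Nat.eqb_refl in F by assumption. lra.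
  - destruct (Nat.eq_dec k i) as [-> | N].
    (* A new disk tangent to [B] would have separation 1, at least the sum of three numbers that are
       each at least 1. *)
    + exfalso.
      assert (HN : exists j, (j < 4)%nat /\ i <> j)
        by (destruct i; [exists 1%nat | exists 0%nat]; lia).
      destruct HN as (j & Hj & Nj).
      destruct (sum4_complete i j Hi Hj Nj) as (k & l & Hk' & Hl & Nki & Nkj & Nli & Nlj & Nkl & Hsum).
      rewrite Hsum, F in Hd.
      pose proof (Hq j Hj ltac:(auto)). pose proof (Hq k Hk' Nki). pose proof (Hq l Hl Nli). lra.
    + rewrite move_other in * by assumption. auto.
Qed.

(** * Symbols and tangency of disks *)

Definition symbol (D : disk) : vec := Vec (xdot D) (ydot D) (curv D) (cocurv D).

Lemma form_symbol_self (D : disk) : wf_disk D -> form (symbol D) (symbol D) = 1.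
Proof.
  destruct D as [[x y] r | [x y] r | [x y] h]; unfold form, symbol, cocurv; simpl; intros H.
  - field. lra.
  - field. lra.
  - lra.
Qed.

(** This is the classical inversive product, by the law of cosines the cosine of an angle when the
    circles cross. *)
Lemma form_round_round (c1 c2 : point) (r1 r2 : R) : 0 < r1 -> 0 < r2 ->
  form (symbol (Round c1 r1)) (symbol (Round c2 r2))
    = (r1 ^ 2 + r2 ^ 2 - sqdist c1 c2) / (2 * r1 * r2).
Proof.
  intros. destruct c1, c2. unfold form, symbol, cocurv, sqdist; simpl. field. lra.
Qed.

Lemma form_round_compl (c1 c2 : point) (r1 r2 : R) : 0 < r1 -> 0 < r2 ->
  form (symbol (Round c1 r1)) (symbol (Compl c2 r2))
    = - ((r1 ^ 2 + r2 ^ 2 - sqdist c1 c2) / (2 * r1 * r2)).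
Proof.
  intros. destruct c1, c2. unfold form, symbol, cocurv, sqdist; simpl. field. lra.
Qed.

Lemma form_round_half (c n : point) (r h : R) : 0 < r ->
  form (symbol (Round c r)) (symbol (Half n h)) = (dot c n - h) / r.
Proof.
  intros. destruct c, n. unfold form, symbol, cocurv, dot; simpl. field. lra.
Qed.

Lemma form_half_half (n1 n2 : point) (h1 h2 : R) :
  form (symbol (Half n1 h1)) (symbol (Half n2 h2)) = dot n1 n2.
Proof. destruct n1, n2. unfold form, symbol, cocurv, dot; simpl. field. Qed.

(** The sign of the curvature determines the kind of disk; then the curvature gives the radius and
    the reduced coordinates the center, or, for a half-plane, the normal and the co-curvature give
    [n] and [h]. *)
Lemma symbol_inj (A B : disk) : wf_disk A -> wf_disk B -> symbol A = symbol B -> A = B.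
Proof.
  assert (I : forall r s, 0 < r -> 0 < s -> 1 / r = 1 / s -> r = s).
  { intros r s Hr Hs E. replace r with (1 / (1 / r)) by (field; lra). rewrite E. field. lra. }
  assert (C : forall r x x', 0 < r -> 1 / r * x = 1 / r * x' -> x = x').
  { intros r x x' Hr E. apply (Rmult_eq_reg_l (1 / r)); [assumption |].
    apply Rgt_not_eq, Rdiv_lt_0_compat; lra. }
  assert (P : forall r, 0 < r -> 0 < 1 / r) by (intros; apply Rdiv_lt_0_compat; lra).
  destruct A as [[x y] r | [x y] r | [x y] h], B as [[x' y'] r' | [x' y'] r' | [x' y'] h'];
    simpl wf_disk; intros HA HB E; pose proof (f_equal vx E) as E1; pose proof (f_equal vy E) as E2;
    pose proof (f_equal va E) as E3; pose proof (f_equal vc E) as E4; clear E; simpl in E1, E2, E3, E4;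
    try (pose proof (P r HA)); try (pose proof (P r' HB)); try lra.
  - assert (r = r') by auto. subst r'. f_equal. f_equal; apply (C r); assumption.
  - assert (r = r') by (apply I; auto; lra). subst r'.
    f_equal. f_equal; apply (C r); try assumption; lra.
  - subst. f_equal. lra.
Qed.

Lemma interiors_disjoint_sym (A B : disk) : interiors_disjoint A B -> interiors_disjoint B A.
Proof. intros H p [H1 H2]. now apply (H p). Qed.

Lemma tangent_disjoint (A B : disk) : tangent A B -> interiors_disjoint A B.
Proof. unfold tangent; tauto. Qed.

Lemma tangent_sym (A B : disk) : tangent A B -> tangent B A.
Proof.
  intros [[H (p & [Hp Hq] & U)] | (HA & HB & H & P)].
  - left. split; [now apply interiors_disjoint_sym |].
    exists p. split; [tauto |]. intros q Hq'. apply U. tauto.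
  - right. repeat split; try assumption; [now apply interiors_disjoint_sym |].
    destruct A, B; simpl in *; try contradiction. lra.
Qed.

(** * Plane geometry: metric consequences of tangency *)

Lemma polar (u1 u2 : R) :
  exists d e1 e2, 0 <= d /\ e1 ^ 2 + e2 ^ 2 = 1 /\ u1 = d * e1 /\ u2 = d * e2.
Proof.
  set (d := sqrt (u1 ^ 2 + u2 ^ 2)).
  assert (Hd : 0 <= d) by apply sqrt_pos.
  assert (Sd : d ^ 2 = u1 ^ 2 + u2 ^ 2) by (unfold d; apply pow2_sqrt; nra).
  destruct (Req_dec d 0) as [E | N].
  (* The direction of the zero vector is an arbitrary choice. *)
  - exists 0, 1, 0. repeat split; nra.
  - exists d, (u1 / d), (u2 / d). repeat split; try (field; assumption); [assumption |].
    replace ((u1 / d) ^ 2 + (u2 / d) ^ 2) with ((u1 ^ 2 + u2 ^ 2) / d ^ 2) by (field; assumption).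
    rewrite Sd. field. rewrite <- Sd. now apply pow_nonzero.
Qed.

Lemma offset_sq (e1 e2 f g t : R) : e1 ^ 2 + e2 ^ 2 = 1 ->
  (f - t * e1) ^ 2 + (g - t * e2) ^ 2 = f ^ 2 + g ^ 2 - 2 * t * (f * e1 + g * e2) + t ^ 2.
Proof.
  intros He.
  transitivity (f ^ 2 + g ^ 2 - 2 * t * (f * e1 + g * e2) + t ^ 2 * (e1 ^ 2 + e2 ^ 2));
    [ring | rewrite He; ring].
Qed.

(** Cauchy-Schwarz, from Lagrange's identity. *)
Lemma unit_dot_bound (e1 e2 u1 u2 r : R) :
  e1 ^ 2 + e2 ^ 2 = 1 -> 0 <= r -> u1 ^ 2 + u2 ^ 2 <= r ^ 2 ->
  - r <= e1 * u1 + e2 * u2 <= r.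
Proof.
  intros He Hr Hu.
  assert (H : (e1 * u1 + e2 * u2) ^ 2 <= r ^ 2).
  { assert ((e1 * u1 + e2 * u2) ^ 2 + (e1 * u2 - e2 * u1) ^ 2
            = (e1 ^ 2 + e2 ^ 2) * (u1 ^ 2 + u2 ^ 2)) by ring.
    rewrite He in *. pose proof (pow2_ge_0 (e1 * u2 - e2 * u1)). lra. }
  split; nra.
Qed.

(** Projecting the common boundary point to the axis of centers bounds their distance [d] above;
    disjoint interiors bound it below. *)
Lemma tangent_round_round (c1 c2 : point) (r1 r2 : R) :
  0 < r1 -> 0 < r2 -> tangent (Round c1 r1) (Round c2 r2) -> sqdist c1 c2 = (r1 + r2) ^ 2.
Proof.
  intros H1 H2 [[D ([p q] & [Hp Hq] & _)] | (F & _)]; [| now destruct F].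
  destruct c1 as [x1 y1], c2 as [x2 y2].
  destruct (polar (x2 - x1) (y2 - y1)) as (d & e1 & e2 & Hd & He & E1 & E2).
  assert (Ex : x2 = x1 + d * e1) by lra. assert (Ey : y2 = y1 + d * e2) by lra. subst x2 y2.
  unfold sqdist in *; simpl fst in *; simpl snd in *.
  unfold in_boundary, sqdist in Hp, Hq; simpl fst in *; simpl snd in *.
  assert (U : d <= r1 + r2).
  { pose proof (unit_dot_bound e1 e2 (p - x1) (q - y1) r1 He ltac:(lra) ltac:(lra)).
    pose proof (unit_dot_bound e1 e2 (p - (x1 + d * e1)) (q - (y1 + d * e2)) r2 He
                  ltac:(lra) ltac:(lra)).
    nra. }
  assert (L : r1 + r2 <= d).
  (* The point dividing the segment of centers in the ratio [r1 : r2] lies at distances [s * r1] and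
     [s * r2] from them, inside both disks. *)
  { apply Rnot_lt_le. intros Hlt. set (s := d / (r1 + r2)).
    assert (Es : d = s * (r1 + r2)) by (unfold s; field; lra).
    assert (Hs : 0 <= s < 1) by (split; nra).
    apply (D (x1 + s * r1 * e1, y1 + s * r1 * e2)). unfold in_interior, sqdist; simpl fst; simpl snd.
    split.
    - replace ((x1 + s * r1 * e1 - x1) ^ 2 + (y1 + s * r1 * e2 - y1) ^ 2)
        with ((s * r1) ^ 2 * (e1 ^ 2 + e2 ^ 2)) by ring.
      rewrite He. assert (s ^ 2 < 1) by nra. assert (0 < r1 ^ 2) by nra. nra.
    - replace ((x1 + s * r1 * e1 - (x1 + d * e1)) ^ 2 + (y1 + s * r1 * e2 - (y1 + d * e2)) ^ 2)
        with ((s * r2) ^ 2 * (e1 ^ 2 + e2 ^ 2)) by (rewrite Es; ring).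
      rewrite He. assert (s ^ 2 < 1) by nra. assert (0 < r2 ^ 2) by nra. nra. }
  replace ((x1 - (x1 + d * e1)) ^ 2 + (y1 - (y1 + d * e2)) ^ 2)
    with (d ^ 2 * (e1 ^ 2 + e2 ^ 2)) by ring.
  rewrite He. replace d with (r1 + r2) by lra. ring.
Qed.

Lemma tangent_round_compl (c1 c2 : point) (r1 r2 : R) :
  0 < r1 -> 0 < r2 -> tangent (Round c1 r1) (Compl c2 r2) ->
  sqdist c1 c2 = (r2 - r1) ^ 2 /\ r1 < r2.
Proof.
  intros H1 H2 [[D ([p q] & [Hp Hq] & Un)] | (F & _)]; [| now destruct F].
  destruct c1 as [x1 y1], c2 as [x2 y2].
  destruct (polar (x1 - x2) (y1 - y2)) as (d & e1 & e2 & Hd & He & E1 & E2).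
  assert (Ex : x1 = x2 + d * e1) by lra. assert (Ey : y1 = y2 + d * e2) by lra. subst x1 y1.
  unfold in_boundary, sqdist in Hp, Hq, Un; simpl fst in *; simpl snd in *.
  unfold sqdist; simpl fst; simpl snd.
  assert (U : r2 <= d + r1).
  { assert (B : (p - x2) ^ 2 + (q - y2) ^ 2 <= (d + r1) ^ 2).
    { pose proof (unit_dot_bound e1 e2 (p - (x2 + d * e1)) (q - (y2 + d * e2)) r1 He
                    ltac:(lra) ltac:(lra)).
      set (f := p - (x2 + d * e1)) in *. set (g := q - (y2 + d * e2)) in *.
      replace (p - x2) with (f + d * e1) by (unfold f; ring).
      replace (q - y2) with (g + d * e2) by (unfold g; ring).
      replace ((f + d * e1) ^ 2 + (g + d * e2) ^ 2)
        with ((f ^ 2 + g ^ 2) + 2 * d * (e1 * f + e2 * g) + d ^ 2 * (e1 ^ 2 + e2 ^ 2)) by ring.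
      rewrite He, Hp. nra. }
    nra. }
  assert (L : d + r1 <= r2).
  { apply Rnot_lt_le. intros Hlt.
    (* The point of the axis at distance [s] beyond the center of the round disk is still inside it,
       yet farther than [r2] from the other center. *)
    assert (Hs : exists s, 0 <= s < r1 /\ r2 < d + s).
    { destruct (Rle_dec d r2).
      - exists ((r1 + (r2 - d)) / 2). lra.
      - exists 0. lra. }
    destruct Hs as (s & Hs & Hs').
    apply (D (x2 + (d + s) * e1, y2 + (d + s) * e2)).
    unfold in_interior, sqdist; simpl fst; simpl snd. split.
    - replace ((x2 + (d + s) * e1 - (x2 + d * e1)) ^ 2 + (y2 + (d + s) * e2 - (y2 + d * e2)) ^ 2)
        with (s ^ 2 * (e1 ^ 2 + e2 ^ 2)) by ring.
      rewrite He. nra.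
    - replace ((x2 + (d + s) * e1 - x2) ^ 2 + (y2 + (d + s) * e2 - y2) ^ 2)
        with ((d + s) ^ 2 * (e1 ^ 2 + e2 ^ 2)) by ring.
      rewrite He. nra. }
  split.
  - replace ((x2 + d * e1 - x2) ^ 2 + (y2 + d * e2 - y2) ^ 2)
      with (d ^ 2 * (e1 ^ 2 + e2 ^ 2)) by ring.
    rewrite He. replace d with (r2 - r1) by lra. ring.
  - destruct (Req_dec d 0) as [E | N]; [exfalso | lra].
    (* concentric circles of equal radius share all their points *)
    assert (r1 = r2) by lra. subst d r2.
    assert (Q : forall s, s ^ 2 = 1 -> (p, q) = (x2 + s * r1, y2)).
    { intros s Hs. apply Un; simpl fst; simpl snd. split.
      - replace ((x2 + s * r1 - (x2 + 0 * e1)) ^ 2 + (y2 - (y2 + 0 * e2)) ^ 2)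
          with (s ^ 2 * r1 ^ 2) by ring. rewrite Hs; ring.
      - replace ((x2 + s * r1 - x2) ^ 2 + (y2 - y2) ^ 2)
          with (s ^ 2 * r1 ^ 2) by ring. rewrite Hs; ring. }
    pose proof (Q 1 ltac:(ring)) as Q1. rewrite (Q (-1) ltac:(ring)) in Q1.
    injection Q1. lra.
Qed.

Lemma tangent_round_half (c n : point) (r h : R) :
  0 < r -> fst n ^ 2 + snd n ^ 2 = 1 -> tangent (Round c r) (Half n h) -> h = dot c n + r.
Proof.
  intros Hr Hn [[D ([p q] & [Hp Hq] & _)] | (F & _)]; [| now destruct F].
  destruct c as [x y], n as [e1 e2].
  unfold in_boundary, sqdist, dot in *; simpl fst in *; simpl snd in *.
  pose proof (unit_dot_bound e1 e2 (p - x) (q - y) r Hn ltac:(lra) ltac:(lra)).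
  apply Rle_antisym; [nra |].
  apply Rnot_lt_le. intros Hlt.
  assert (Hs : exists s, 0 <= s < r /\ h < x * e1 + y * e2 + s).
  { destruct (Rle_dec (x * e1 + y * e2) h).
    - exists ((r + (h - (x * e1 + y * e2))) / 2). lra.
    - exists 0. lra. }
  destruct Hs as (s & Hs & Hs').
  apply (D (x + s * e1, y + s * e2)). unfold in_interior, sqdist, dot; simpl fst; simpl snd. split.
  - replace ((x + s * e1 - x) ^ 2 + (y + s * e2 - y) ^ 2) with (s ^ 2 * (e1 ^ 2 + e2 ^ 2)) by ring.
    rewrite Hn. nra.
  - replace ((x + s * e1) * e1 + (y + s * e2) * e2)
      with (x * e1 + y * e2 + s * (e1 ^ 2 + e2 ^ 2)) by ring.
    rewrite Hn. lra.
Qed.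

(** Far points in the direction [n1 + n2] lie in both half-planes unless the normals are opposite,
    since this vector has product [1 + dot n1 n2] with each normal. *)
Lemma disjoint_half_half (n1 n2 : point) (h1 h2 : R) :
  fst n1 ^ 2 + snd n1 ^ 2 = 1 -> fst n2 ^ 2 + snd n2 ^ 2 = 1 ->
  interiors_disjoint (Half n1 h1) (Half n2 h2) -> dot n1 n2 = -1.
Proof.
  destruct n1 as [a b], n2 as [c d]. unfold dot; simpl fst; simpl snd. intros H1 H2 D.
  destruct (unit_dot_bound a b c d 1 H1) as [L _]; [lra | lra |].
  destruct L as [L | L]; [exfalso | lra].
  set (s := 1 + (a * c + b * d)). assert (Hs : 0 < s) by (unfold s; lra).
  set (t := (Rabs h1 + Rabs h2 + 1) / s).
  assert (Ht : t * s = Rabs h1 + Rabs h2 + 1) by (unfold t; field; lra).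
  pose proof (Rle_abs h1). pose proof (Rle_abs h2).
  pose proof (Rabs_pos h1). pose proof (Rabs_pos h2).
  apply (D (t * (a + c), t * (b + d))). unfold in_interior, dot; simpl fst; simpl snd. split.
  - replace (t * (a + c) * a + t * (b + d) * b) with (t * ((a ^ 2 + b ^ 2) + (a * c + b * d))) by ring.
    rewrite H1. fold s. lra.
  - replace (t * (a + c) * c + t * (b + d) * d) with (t * ((c ^ 2 + d ^ 2) + (a * c + b * d))) by ring.
    rewrite H2. fold s. lra.
Qed.

Lemma compl_compl_meet (c1 c2 : point) (r1 r2 : R) :
  ~ interiors_disjoint (Compl c1 r1) (Compl c2 r2).
Proof.
  destruct c1 as [x1 y1], c2 as [x2 y2]. intros D.
  pose proof (Rle_abs x1). pose proof (Rle_abs x2). pose proof (Rle_abs r1). pose proof (Rle_abs r2).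
  pose proof (Rle_abs (- r1)). pose proof (Rle_abs (- r2)). rewrite Rabs_Ropp in *.
  pose proof (Rabs_pos x1). pose proof (Rabs_pos x2).
  set (t := Rabs x1 + Rabs x2 + Rabs r1 + Rabs r2 + 1).
  apply (D (t, 0)). unfold in_interior, sqdist; simpl fst; simpl snd.
  assert (r1 < t - x1 /\ - r1 < t - x1) by (unfold t; lra).
  assert (r2 < t - x2 /\ - r2 < t - x2) by (unfold t; lra).
  pose proof (pow2_ge_0 (0 - y1)). pose proof (pow2_ge_0 (0 - y2)). split; nra.
Qed.

Lemma compl_half_meet (c n : point) (r h : R) :
  fst n ^ 2 + snd n ^ 2 = 1 -> ~ interiors_disjoint (Compl c r) (Half n h).
Proof.
  destruct c as [x y], n as [e1 e2]; simpl fst; simpl snd. intros He D.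
  set (k := x * e1 + y * e2).
  pose proof (Rle_abs r). pose proof (Rle_abs (- r)). pose proof (Rle_abs (h - k)).
  rewrite Rabs_Ropp in *. pose proof (Rabs_pos r). pose proof (Rabs_pos (h - k)).
  set (t := Rabs r + Rabs (h - k) + 1).
  assert (r < t /\ - r < t) by (unfold t; lra).
  apply (D (x + t * e1, y + t * e2)). unfold in_interior, sqdist, dot; simpl fst; simpl snd. split.
  - replace ((x + t * e1 - x) ^ 2 + (y + t * e2 - y) ^ 2) with (t ^ 2 * (e1 ^ 2 + e2 ^ 2)) by ring.
    rewrite He. nra.
  - replace ((x + t * e1) * e1 + (y + t * e2) * e2) with (k + t * (e1 ^ 2 + e2 ^ 2))
      by (unfold k; ring).
    rewrite He. unfold t. lra.
Qed.

(** The form is unchanged when both symbols are negated, so it is also -1 for the complements of two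
    tangent disks; the signs of the curvatures tell the two situations apart. *)
Definition curv_compatible (A B : disk) : Prop :=
  0 < curv A + curv B \/ (curv A = 0 /\ curv B = 0).

Lemma curv_compatible_sym (A B : disk) : curv_compatible A B -> curv_compatible B A.
Proof. unfold curv_compatible; intros [? | ?]; [left; lra | right; tauto]. Qed.

Lemma tangent_form (A B : disk) :
  wf_disk A -> wf_disk B -> tangent A B ->
  form (symbol A) (symbol B) = -1 /\ curv_compatible A B.
Proof.
  assert (P : forall r, 0 < r -> 0 < 1 / r) by (intros; apply Rdiv_lt_0_compat; lra).
  assert (RC : forall c1 c2 r1 r2, 0 < r1 -> 0 < r2 -> tangent (Round c1 r1) (Compl c2 r2) ->
    form (symbol (Round c1 r1)) (symbol (Compl c2 r2)) = -1 /\
    curv_compatible (Round c1 r1) (Compl c2 r2)).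
  { intros c1 c2 r1 r2 H1 H2 T. destruct (tangent_round_compl _ _ _ _ H1 H2 T) as [E L].
    split.
    - rewrite form_round_compl, E by assumption. field. lra.
    - left. simpl. replace (1 / r1 + - (1 / r2)) with ((r2 - r1) / (r1 * r2)) by (field; lra).
      apply Rdiv_lt_0_compat; nra. }
  assert (RH : forall c n r h, 0 < r -> fst n ^ 2 + snd n ^ 2 = 1 -> tangent (Round c r) (Half n h) ->
    form (symbol (Round c r)) (symbol (Half n h)) = -1 /\ curv_compatible (Round c r) (Half n h)).
  { intros c n r h Hr Hn T. pose proof (tangent_round_half _ _ _ _ Hr Hn T) as E.
    split.
    - rewrite form_round_half, E by assumption. field. lra.
    - left. simpl. pose proof (P r Hr). lra. }
  destruct A as [c1 r1 | c1 r1 | n1 h1], B as [c2 r2 | c2 r2 | n2 h2]; intros HA HB T.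
  - simpl in HA, HB. split.
    + rewrite form_round_round, (tangent_round_round _ _ _ _ HA HB T) by assumption. field. lra.
    + left. simpl. pose proof (P r1 HA). pose proof (P r2 HB). lra.
  - now apply RC.
  - now apply RH.
  - apply tangent_sym in T. rewrite form_sym. destruct (RC _ _ _ _ HB HA T). auto using curv_compatible_sym.
  - now apply tangent_disjoint, compl_compl_meet in T.
  - now apply tangent_disjoint, compl_half_meet in T.
  - apply tangent_sym in T. rewrite form_sym. destruct (RH _ _ _ _ HB HA T). auto using curv_compatible_sym.
  - now apply tangent_sym, tangent_disjoint, compl_half_meet in T.
  - split; [| right; split; reflexivity].
    rewrite form_half_half. apply disjoint_half_half with h1 h2; try assumption.
    now apply tangent_disjoint.
Qed.

(** * From metric relations and symbols back to tangency *)

Lemma tangent_of_round_round (c1 c2 : point) (r1 r2 : R) :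
  0 < r1 -> 0 < r2 -> sqdist c1 c2 = (r1 + r2) ^ 2 -> tangent (Round c1 r1) (Round c2 r2).
Proof.
  destruct c1 as [x1 y1], c2 as [x2 y2]. intros H1 H2.
  destruct (polar (x2 - x1) (y2 - y1)) as (d & e1 & e2 & Hd & He & E1 & E2).
  assert (Ex : x2 = x1 + d * e1) by lra. assert (Ey : y2 = y1 + d * e2) by lra. subst x2 y2.
  unfold sqdist; simpl fst; simpl snd.
  replace ((x1 - (x1 + d * e1)) ^ 2 + (y1 - (y1 + d * e2)) ^ 2)
    with (d ^ 2 * (e1 ^ 2 + e2 ^ 2)) by ring.
  rewrite He. intros E. assert (Ed : d = r1 + r2) by nra. subst d. left. split.
  - intros [p q] [Hp Hq]. unfold in_interior, sqdist in *; simpl fst in *; simpl snd in *.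
    set (f := p - x1) in *. set (g := q - y1) in *.
    replace (p - (x1 + (r1 + r2) * e1)) with (f - (r1 + r2) * e1) in Hq by (unfold f; ring).
    replace (q - (y1 + (r1 + r2) * e2)) with (g - (r1 + r2) * e2) in Hq by (unfold g; ring).
    rewrite offset_sq in Hq by assumption.
    pose proof (unit_dot_bound e1 e2 f g r1 He ltac:(lra) ltac:(lra)).
    pose proof (offset_sq e1 e2 f g r1 He).
    pose proof (pow2_ge_0 (f - r1 * e1)). pose proof (pow2_ge_0 (g - r1 * e2)). nra.
  - exists (x1 + r1 * e1, y1 + r1 * e2). unfold in_boundary, sqdist; simpl fst; simpl snd.
    split; [split |]; simpl fst; simpl snd.
    + replace ((x1 + r1 * e1 - x1) ^ 2 + (y1 + r1 * e2 - y1) ^ 2)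
        with (r1 ^ 2 * (e1 ^ 2 + e2 ^ 2)) by ring. rewrite He; ring.
    + replace ((x1 + r1 * e1 - (x1 + (r1 + r2) * e1)) ^ 2
               + (y1 + r1 * e2 - (y1 + (r1 + r2) * e2)) ^ 2)
        with (r2 ^ 2 * (e1 ^ 2 + e2 ^ 2)) by ring. rewrite He; ring.
    + intros [p q] [Hp Hq]; simpl fst in *; simpl snd in *.
      assert (Z : (p - (x1 + r1 * e1)) ^ 2 + (q - (y1 + r1 * e2)) ^ 2 = 0).
      { set (f := p - x1) in *. set (g := q - y1) in *.
        replace (p - (x1 + (r1 + r2) * e1)) with (f - (r1 + r2) * e1) in Hq by (unfold f; ring).
        replace (q - (y1 + (r1 + r2) * e2)) with (g - (r1 + r2) * e2) in Hq by (unfold g; ring).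
        replace (p - (x1 + r1 * e1)) with (f - r1 * e1) by (unfold f; ring).
        replace (q - (y1 + r1 * e2)) with (g - r1 * e2) by (unfold g; ring).
        rewrite offset_sq in * by assumption. rewrite Hp in *.
        (* Subtracting the two circle equations gives the radical axis, which meets the circles only
           at the contact point. *)
        assert (K : (r1 + r2) * (f * e1 + g * e2 - r1) = 0) by lra.
        apply Rmult_integral in K. destruct K as [K | K]; [lra |].
        replace (f * e1 + g * e2) with r1 by lra. ring. }
      apply sum_sq_zero in Z. f_equal; lra.
Qed.

Lemma tangent_of_round_compl (c1 c2 : point) (r1 r2 : R) :
  0 < r1 -> r1 < r2 -> sqdist c1 c2 = (r2 - r1) ^ 2 -> tangent (Round c1 r1) (Compl c2 r2).
Proof.
  destruct c1 as [x1 y1], c2 as [x2 y2]. intros H1 H2.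
  destruct (polar (x1 - x2) (y1 - y2)) as (d & e1 & e2 & Hd & He & E1 & E2).
  assert (Ex : x1 = x2 + d * e1) by lra. assert (Ey : y1 = y2 + d * e2) by lra. subst x1 y1.
  unfold sqdist; simpl fst; simpl snd.
  replace ((x2 + d * e1 - x2) ^ 2 + (y2 + d * e2 - y2) ^ 2)
    with (d ^ 2 * (e1 ^ 2 + e2 ^ 2)) by ring.
  rewrite He. intros E. assert (Ed : d = r2 - r1) by nra. subst d.
  assert (S : forall p q, (p - (x2 + (r2 - r1) * e1)) ^ 2 + (q - (y2 + (r2 - r1) * e2)) ^ 2
    = (p - x2) ^ 2 + (q - y2) ^ 2 - 2 * (r2 - r1) * ((p - x2) * e1 + (q - y2) * e2)
      + (r2 - r1) ^ 2).
  { intros p q. rewrite <- offset_sq by assumption. ring. }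
  left. split.
  - intros [p q] [Hp Hq]. unfold in_interior, sqdist in *; simpl fst in *; simpl snd in *.
    pose proof (unit_dot_bound e1 e2 (p - (x2 + (r2 - r1) * e1)) (q - (y2 + (r2 - r1) * e2)) r1 He
      ltac:(lra) ltac:(lra)) as [_ B].
    rewrite S in Hp.
    assert (B' : (p - x2) * e1 + (q - y2) * e2 <= r2) by nra. nra.
  - exists (x2 + r2 * e1, y2 + r2 * e2). unfold in_boundary, sqdist; simpl fst; simpl snd.
    split; [split |]; simpl fst; simpl snd.
    + replace ((x2 + r2 * e1 - (x2 + (r2 - r1) * e1)) ^ 2 + (y2 + r2 * e2 - (y2 + (r2 - r1) * e2)) ^ 2)
        with (r1 ^ 2 * (e1 ^ 2 + e2 ^ 2)) by ring. rewrite He; ring.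
    + replace ((x2 + r2 * e1 - x2) ^ 2 + (y2 + r2 * e2 - y2) ^ 2)
        with (r2 ^ 2 * (e1 ^ 2 + e2 ^ 2)) by ring. rewrite He; ring.
    + intros [p q] [Hp Hq]; simpl fst in *; simpl snd in *.
      rewrite S, Hq in Hp.
      set (f := p - x2) in *. set (g := q - y2) in *.
      assert (K : (r2 - r1) * (f * e1 + g * e2 - r2) = 0) by lra.
      apply Rmult_integral in K. destruct K as [K | K]; [lra |].
      assert (Z : (f - r2 * e1) ^ 2 + (g - r2 * e2) ^ 2 = 0).
      { rewrite offset_sq, Hq by assumption.
        replace (f * e1 + g * e2) with r2 by lra. ring. }
      apply sum_sq_zero in Z. unfold f, g in Z. f_equal; lra.
Qed.

Lemma tangent_of_round_half (c n : point) (r h : R) :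
  0 < r -> fst n ^ 2 + snd n ^ 2 = 1 -> h = dot c n + r -> tangent (Round c r) (Half n h).
Proof.
  destruct c as [x y], n as [e1 e2]. unfold dot; simpl fst; simpl snd. intros Hr He ->. left. split.
  - intros [p q] [Hp Hq]. unfold in_interior, sqdist, dot in *; simpl fst in *; simpl snd in *.
    pose proof (unit_dot_bound e1 e2 (p - x) (q - y) r He ltac:(lra) ltac:(lra)). nra.
  - exists (x + r * e1, y + r * e2). unfold in_boundary, sqdist, dot; simpl fst; simpl snd.
    split; [split |]; simpl fst; simpl snd.
    + replace ((x + r * e1 - x) ^ 2 + (y + r * e2 - y) ^ 2)
        with (r ^ 2 * (e1 ^ 2 + e2 ^ 2)) by ring. rewrite He; ring.
    + replace ((x + r * e1) * e1 + (y + r * e2) * e2)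
        with (x * e1 + y * e2 + r * (e1 ^ 2 + e2 ^ 2)) by ring. rewrite He; ring.
    + intros [p q] [Hp Hq]; simpl fst in *; simpl snd in *.
      assert (Z : (p - (x + r * e1)) ^ 2 + (q - (y + r * e2)) ^ 2 = 0).
      { transitivity ((p - x) ^ 2 + (q - y) ^ 2 - 2 * r * (p * e1 + q * e2 - (x * e1 + y * e2))
                      + r ^ 2 * (e1 ^ 2 + e2 ^ 2)); [ring |].
        rewrite Hp, Hq, He. ring. }
      apply sum_sq_zero in Z. f_equal; lra.
Qed.

Lemma tangent_of_half_half (n1 n2 : point) (h1 h2 : R) :
  fst n1 ^ 2 + snd n1 ^ 2 = 1 -> fst n2 ^ 2 + snd n2 ^ 2 = 1 ->
  dot n1 n2 = -1 -> 0 <= h1 + h2 -> tangent (Half n1 h1) (Half n2 h2).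
Proof.
  destruct n1 as [a b], n2 as [c d]. unfold dot; simpl fst; simpl snd. intros H1 H2 E H.
  (* The squared norm of [n1 + n2] is [2 + 2 * dot n1 n2]. *)
  assert (Z : (a + c) ^ 2 + (b + d) ^ 2 = 0) by nra. apply sum_sq_zero in Z.
  assert (c = - a) by lra. assert (d = - b) by lra. subst c d.
  right. repeat split.
  - intros [p q] [Hp Hq]. unfold in_interior, dot in *; simpl fst in *; simpl snd in *. nra.
  - simpl. ring.
Qed.

(** For two half-planes the form yields only opposite normals, and the sign of the sum of the
    co-curvatures decides whether they overlap. *)
Lemma form_tangent (A B : disk) :
  wf_disk A -> wf_disk B -> form (symbol A) (symbol B) = -1 -> curv_compatible A B ->
  0 <= cocurv A + cocurv B -> tangent A B.
Proof.
  assert (P : forall r, 0 < r -> 0 < 1 / r) by (intros; apply Rdiv_lt_0_compat; lra).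
  assert (RC : forall c1 c2 r1 r2, 0 < r1 -> 0 < r2 ->
    form (symbol (Round c1 r1)) (symbol (Compl c2 r2)) = -1 ->
    curv_compatible (Round c1 r1) (Compl c2 r2) -> tangent (Round c1 r1) (Compl c2 r2)).
  { intros c1 c2 r1 r2 H1 H2 F C. pose proof (P r1 H1). pose proof (P r2 H2).
    rewrite form_round_compl in F by assumption.
    destruct C as [C | [C _]]; simpl in C; [| lra].
    apply tangent_of_round_compl; [assumption | |].
    - apply Rnot_le_lt. intros L. pose proof (Rinv_le_contravar r2 r1 H2 L). lra.
    - assert (E : sqdist c1 c2 = r1 ^ 2 + r2 ^ 2 +
        - ((r1 ^ 2 + r2 ^ 2 - sqdist c1 c2) / (2 * r1 * r2)) * (2 * r1 * r2)) by (field; lra).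
      rewrite F in E. lra. }
  assert (RH : forall c n r h, 0 < r -> fst n ^ 2 + snd n ^ 2 = 1 ->
    form (symbol (Round c r)) (symbol (Half n h)) = -1 -> tangent (Round c r) (Half n h)).
  { intros c n r h Hr Hn F. rewrite form_round_half in F by assumption.
    apply tangent_of_round_half; try assumption.
    assert (E : h = dot c n - (dot c n - h) / r * r) by (field; lra). rewrite F in E. lra. }
  destruct A as [c1 r1 | c1 r1 | n1 h1], B as [c2 r2 | c2 r2 | n2 h2]; intros HA HB F C H;
    simpl in HA, HB; try (pose proof (P r1 HA)); try (pose proof (P r2 HB)).
  - apply tangent_of_round_round; try assumption.
    rewrite form_round_round in F by assumption.
    assert (E : sqdist c1 c2 = r1 ^ 2 + r2 ^ 2 -
      (r1 ^ 2 + r2 ^ 2 - sqdist c1 c2) / (2 * r1 * r2) * (2 * r1 * r2)) by (field; lra).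
    rewrite F in E. lra.
  - now apply RC.
  - now apply RH.
  - apply tangent_sym, RC; try assumption; [now rewrite form_sym | now apply curv_compatible_sym].
  - destruct C as [C | [C _]]; simpl in C; lra.
  - destruct C as [C | [C _]]; simpl in C; lra.
  - apply tangent_sym, RH; try assumption. now rewrite form_sym.
  - destruct C as [C | [_ C]]; simpl in C; lra.
  - rewrite form_half_half in F. simpl in H. apply tangent_of_half_half; try assumption. lra.
Qed.

(** * Existence of a Gaussian configuration *)

(* The positive semidefinite Hermitian matrix [[P, a + b i], [a - b i, R]] of rank one over Z[i]
   is [k w w'] with [w = (u, v)] unimodular, as witnessed by [p u + q v = 1]. *)
Definition rank_one (P R a b : Z) : Prop :=
  exists k u1 u2 v1 v2 p1 p2 q1 q2 : Z,
    (0 <= k /\ P = k * (u1 * u1 + u2 * u2) /\ R = k * (v1 * v1 + v2 * v2) /\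
     a = k * (u1 * v1 + u2 * v2) /\ b = k * (u2 * v1 - u1 * v2) /\
     p1 * u1 - p2 * u2 + q1 * v1 - q2 * v2 = 1 /\
     p1 * u2 + p2 * u1 + q1 * v2 + q2 * v1 = 0)%Z.

Lemma rank_one_swap (P R a b : Z) : rank_one R P a (- b) -> rank_one P R a b.
Proof.
  intros (k & u1 & u2 & v1 & v2 & p1 & p2 & q1 & q2 & Hk & HP & HR & Ha & Hb & H1 & H2).
  exists k, v1, v2, u1, u2, q1, q2, p1, p2. repeat split; lia.
Qed.

(** An elementary congruence: [v] becomes [v + (s - t i) u], and the Bezout coefficient [p] becomes
    [p - (s - t i) q]. *)
Lemma rank_one_shear (P R a b s t : Z) :
  rank_one P (R - 2 * (s * a + t * b) + (s * s + t * t) * P) (a - s * P) (b - t * P) ->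
  rank_one P R a b.
Proof.
  intros (k & u1 & u2 & v1 & v2 & p1 & p2 & q1 & q2 & Hk & HP & HR & Ha & Hb & H1 & H2).
  exists k, u1, u2, (s * u1 + t * u2 + v1)%Z, (s * u2 - t * u1 + v2)%Z,
    (p1 - (q1 * s + q2 * t))%Z, (p2 - (q2 * s - q1 * t))%Z, q1, q2.
  assert (Ea : a = (s * P + k * (u1 * v1 + u2 * v2))%Z) by lia.
  assert (Eb : b = (t * P + k * (u2 * v1 - u1 * v2))%Z) by lia.
  assert (ER : R = (2 * (s * a + t * b) - (s * s + t * t) * P + k * (v1 * v1 + v2 * v2))%Z) by lia.
  split; [assumption |]. split; [assumption |].
  split; [rewrite ER, Ea, Eb, HP; ring |].
  split; [rewrite Ea, HP; ring |]. split; [rewrite Eb, HP; ring |].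
  split; [rewrite <- H1; ring | rewrite <- H2; ring].
Qed.

Lemma centered_remainder (a P : Z) : (0 < P)%Z -> exists s, (- P <= 2 * (a - s * P) <= P)%Z.
Proof.
  (* [s] is [a / P] rounded to a nearest integer. *)
  intros HP. exists ((2 * a + P) / (2 * P))%Z.
  pose proof (Z.div_mod (2 * a + P) (2 * P) ltac:(lia)).
  pose proof (Z.mod_pos_bound (2 * a + P) (2 * P) ltac:(lia)). nia.
Qed.

(* Euclid's algorithm in Z[i]: reducing [a + b i] modulo the smaller diagonal entry [P] brings
   the other one below [P / 2]. *)
Lemma rank_one_of_det (P R a b : Z) :
  (0 <= P)%Z -> (0 <= R)%Z -> (P * R = a * a + b * b)%Z -> rank_one P R a b.
Proof.
  intros HP HR.
  remember (Z.to_nat (P + R)) as n eqn:En. revert P R a b HP HR En.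
  induction n as [n IH] using lt_wf_ind. intros P R a b HP HR En HD.
  assert (L : forall P R a b, (0 <= P)%Z -> (P <= R)%Z -> n = Z.to_nat (P + R) ->
    (P * R = a * a + b * b)%Z -> rank_one P R a b).
  { clear P R a b HP HR En HD. intros P R a b HP HR En HD.
    destruct (Z.eq_dec P 0) as [-> | NP].
    (* The matrix is diagonal with entries 0 and [R], so [k = R] and [w = (0, 1)]. *)
    - assert (a = 0 /\ b = 0)%Z as [-> ->] by nia.
      exists R, 0%Z, 0%Z, 1%Z, 0%Z, 0%Z, 0%Z, 1%Z, 0%Z. lia.
    - destruct (centered_remainder a P ltac:(lia)) as [s Hs].
      destruct (centered_remainder b P ltac:(lia)) as [t Ht].
      apply (rank_one_shear P R a b s t).
      set (R' := (R - 2 * (s * a + t * b) + (s * s + t * t) * P)%Z).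
      assert (E : (P * R' = (a - s * P) * (a - s * P) + (b - t * P) * (b - t * P))%Z).
      { transitivity (P * R - 2 * P * (s * a + t * b) + (s * s + t * t) * P * P)%Z;
          [unfold R'; ring | rewrite HD; ring]. }
      assert (B : forall x, (- P <= 2 * x <= P -> 4 * (x * x) <= P * P)%Z) by (intros; nia).
      pose proof (B _ Hs) as Bs. pose proof (B _ Ht) as Bt.
      clearbody R'.
      assert (0 <= P * R' /\ 2 * (P * R') <= P * P)%Z as [E1 E2]
        by (rewrite E; split; [apply Z.add_nonneg_nonneg; apply Z.square_nonneg | lia]).
      assert (0 <= R')%Z by nia. assert (2 * R' <= P)%Z by nia.
      apply (IH (Z.to_nat (P + R'))); try lia. }
  destruct (Z.le_ge_cases P R).
  - now apply L.
  - apply rank_one_swap, L; try lia.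
Qed.

(** * Disks from symbols, and symbols from spinors *)

Definition disk_of (v : vec) : disk :=
  if Rlt_dec 0 (va v) then Round (vx v / va v, vy v / va v) (1 / va v)
  else if Rlt_dec (va v) 0 then Compl (vx v / va v, vy v / va v) (- (1 / va v))
  else Half (vx v, vy v) (vc v / 2).

Lemma disk_of_symbol (v : vec) :
  form v v = 1 -> wf_disk (disk_of v) /\ symbol (disk_of v) = v.
Proof.
  destruct v as [x y a c]. unfold form, disk_of, symbol; cbn [vx vy va vc]. intros H.
  destruct (Rlt_dec 0 a) as [P | P]; [| destruct (Rlt_dec a 0) as [N | N]].
  - split; [apply Rdiv_lt_0_compat; lra |].
    unfold cocurv; simpl. f_equal; try (field; lra).
    apply (Rmult_eq_reg_l a); [| lra].
    transitivity (x ^ 2 + y ^ 2 - 1); [field; lra | lra].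
  - split.
    + simpl. replace (- (1 / a)) with (1 / (- a)) by (field; lra). apply Rdiv_lt_0_compat; lra.
    + unfold cocurv; simpl. f_equal; try (field; lra).
      apply (Rmult_eq_reg_l a); [| lra].
      transitivity (x ^ 2 + y ^ 2 - 1); [field; lra | lra].
  - assert (a = 0) by lra. subst a. split; simpl; [lra |]. f_equal; field.
Qed.

(* With [be = b1 + b2 i], [ga = g1 + g2 i], [p], [q] in Z[i], [p ga + q be = 1], put
   [xi = be + 2 i p] and [eta = ga - 2 i q], so that [xi ga - eta be = 2 i]. Disk 0 is the
   Hermitian matrix [i / 2 (s t' - t s')] for [s = (xi, be)], [t = (eta, ga)] and ['] the conjugate
   transpose; its sums with disks 1, 2, 3 are the null matrices [s s'], [t t'] and
   [(s + t) (s + t)']. *)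
Definition spinor_disk (b1 b2 g1 g2 p1 p2 q1 q2 : R) : vec :=
  let A := g2 * b1 - g1 * b2 in
  Vec (A - (p1 * g1 + p2 * g2 + q1 * b1 + q2 * b2))
      (- (p2 * g1 - p1 * g2 + q2 * b1 - q1 * b2))
      A ((g2 - 2 * q1) * (b1 - 2 * p2) - (g1 + 2 * q2) * (b2 + 2 * p1)).

(** The symbols of two tangent disks add up to a null vector; here that vector is [s s'] for the
    spinor [s = (x1 + x2 i, b1 + b2 i)]. *)
Definition null_minus (x1 x2 b1 b2 : R) (v : vec) : vec :=
  Vec (x1 * b1 + x2 * b2 - vx v) (x2 * b1 - x1 * b2 - vy v)
      (b1 ^ 2 + b2 ^ 2 - va v) (x1 ^ 2 + x2 ^ 2 - vc v).

Definition spinor_config (b1 b2 g1 g2 p1 p2 q1 q2 : R) (i : nat) : vec :=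
  let V0 := spinor_disk b1 b2 g1 g2 p1 p2 q1 q2 in
  match i with
  | 0%nat => V0
  | 1%nat => null_minus (b1 - 2 * p2) (b2 + 2 * p1) b1 b2 V0
  | 2%nat => null_minus (g1 + 2 * q2) (g2 - 2 * q1) g1 g2 V0
  | _ => null_minus (b1 + g1 - 2 * (p2 - q2)) (b2 + g2 + 2 * (p1 - q1)) (b1 + g1) (b2 + g2) V0
  end.

Lemma spinor_config_gram (b1 b2 g1 g2 p1 p2 q1 q2 : R) :
  p1 * g1 - p2 * g2 + q1 * b1 - q2 * b2 = 1 -> p1 * g2 + p2 * g1 + q1 * b2 + q2 * b1 = 0 ->
  gram (spinor_config b1 b2 g1 g2 p1 p2 q1 q2).
Proof.
  intros H1 H2.
  (* [e] is the squared modulus of [p ga + q be]. Kept symbolic, it makes every product a polynomial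
     identity. *)
  set (e := (p1 * g1 - p2 * g2 + q1 * b1 - q2 * b2) ^ 2
            + (p1 * g2 + p2 * g1 + q1 * b2 + q2 * b1) ^ 2).
  assert (He : e = 1) by (unfold e; rewrite H1, H2; ring).
  assert (S : forall i j, (i < 4)%nat -> (j < 4)%nat ->
    form (spinor_config b1 b2 g1 g2 p1 p2 q1 q2 i) (spinor_config b1 b2 g1 g2 p1 p2 q1 q2 j)
    = if Nat.eqb i j then e else - e).
  { clear. intros i j Hi Hj. unfold e.
    case4 i Hi; case4 j Hj; unfold form, spinor_config, spinor_disk, null_minus;
      cbn [vx vy va vc Nat.eqb]; field. }
  intros i j Hi Hj. rewrite S, He by assumption. destruct (Nat.eqb i j); ring.
Qed.

Lemma spinor_config_lattice (b1 b2 g1 g2 p1 p2 q1 q2 : Z) (i : nat) : (i < 4)%nat ->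
  lattice (spinor_config (IZR b1) (IZR b2) (IZR g1) (IZR g2) (IZR p1) (IZR p2) (IZR q1) (IZR q2) i).
Proof.
  intros Hi.
  set (A := (g2 * b1 - g1 * b2)%Z).
  set (x := (A - (p1 * g1 + p2 * g2 + q1 * b1 + q2 * b2))%Z).
  set (y := (- (p2 * g1 - p1 * g2 + q2 * b1 - q1 * b2))%Z).
  set (z := (g1 * p1 + g2 * p2 + q1 * b1 + q2 * b2 + 2 * (q2 * p1 - q1 * p2))%Z).
  (* Disks 1, 2, 3 come from spinors [(d + 2 i r, d)] with [r] equal to [p], [-q], [p - q]; the
     entries [|d + 2 i r|^2] and [|d|^2] have the same parity. *)
  assert (N : forall r1 r2 d1 d2, lattice
    (null_minus (IZR d1 - 2 * IZR r2) (IZR d2 + 2 * IZR r1) (IZR d1) (IZR d2)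
       (spinor_disk (IZR b1) (IZR b2) (IZR g1) (IZR g2) (IZR p1) (IZR p2) (IZR q1) (IZR q2)))).
  { intros r1 r2 d1 d2.
    set (w := (- 2 * (r1 * d2 - r2 * d1) - 2 * (r1 * r1 + r2 * r2) - z)%Z).
    exists ((d1 - 2 * r2) * d1 + (d2 + 2 * r1) * d2 - x)%Z,
      ((d2 + 2 * r1) * d1 - (d1 - 2 * r2) * d2 - y)%Z, w, (d1 * d1 + d2 * d2 - A - w)%Z.
    unfold null_minus, spinor_disk, w, z, y, x, A; cbn [vx vy va vc].
    repeat (rewrite minus_IZR || rewrite plus_IZR || rewrite mult_IZR || rewrite opp_IZR).
    f_equal; ring. }
  case4 i Hi; unfold spinor_config.
  - exists x, y, z, (A - z)%Z. unfold spinor_disk, z, y, x, A.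
    repeat (rewrite minus_IZR || rewrite plus_IZR || rewrite mult_IZR || rewrite opp_IZR).
    f_equal; ring.
  - apply N.
  - replace (IZR g1 + 2 * IZR q2) with (IZR g1 - 2 * IZR (- q2)) by (rewrite opp_IZR; ring).
    replace (IZR g2 - 2 * IZR q1) with (IZR g2 + 2 * IZR (- q1)) by (rewrite opp_IZR; ring).
    apply N.
  - rewrite <- !plus_IZR, <- !minus_IZR. apply N.
Qed.


Lemma spinor_config_spin (b1 b2 g1 g2 p1 p2 q1 q2 : Z) (i j : nat) :
  (p1 * g1 - p2 * g2 + q1 * b1 - q2 * b2 = 1)%Z -> (p1 * g2 + p2 * g1 + q1 * b2 + q2 * b1 = 0)%Z ->
  (i < 4)%nat -> (j < 4)%nat -> i <> j ->
  let V := spinor_config (IZR b1) (IZR b2) (IZR g1) (IZR g2) (IZR p1) (IZR p2) (IZR q1) (IZR q2) in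
  gauss_spin (V i) (V j).
Proof.
  intros H1 H2 Hi Hj Hij V.
  apply (f_equal IZR) in H1, H2.
  repeat (rewrite minus_IZR in * || rewrite plus_IZR in * || rewrite mult_IZR in *).
  set (e1 := IZR p1 * IZR g1 - IZR p2 * IZR g2 + IZR q1 * IZR b1 - IZR q2 * IZR b2) in *.
  set (e2 := IZR p1 * IZR g2 + IZR p2 * IZR g1 + IZR q1 * IZR b2 + IZR q2 * IZR b1) in *.
  (* The squared spinors are [(e1 + e2 i) (m + n i)^2] as polynomial identities, where
     [e1 + e2 i = p ga + q be = 1]. *)
  assert (S : forall i j m n, (i < 4)%nat -> (j < 4)%nat ->
    spin_re (V i) (V j) = e1 * (IZR m ^ 2 - IZR n ^ 2) - e2 * (2 * IZR m * IZR n) ->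
    spin_im (V i) (V j) = e2 * (IZR m ^ 2 - IZR n ^ 2) + e1 * (2 * IZR m * IZR n) ->
    gauss_spin (V i) (V j)).
  { intros i' j' m n _ _ E1 E2. exists m, n. rewrite E1, E2, H1, H2. split; ring. }
  clear H1 H2.
  assert (O : forall i j, (i < 4)%nat -> (j < 4)%nat -> (i < j)%nat -> gauss_spin (V i) (V j)).
  { clear i j Hi Hj Hij. intros i j Hi Hj Hij.
    (* The spinors are the conjugates of [be], [ga], [be + ga] for disk 0, then of [be + i ga],
       [be + i (be + ga)] and [ga - i (be + ga)]. *)
    case4 i Hi; case4 j Hj; try lia;
      [ apply (S _ _ b1 (- b2)%Z) | apply (S _ _ g1 (- g2)%Z)
      | apply (S _ _ (b1 + g1)%Z (- (b2 + g2))%Z)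
      | apply (S _ _ (b1 - g2)%Z (- b2 - g1)%Z)
      | apply (S _ _ (b1 - (b2 + g2))%Z (- b2 - (b1 + g1))%Z)
      | apply (S _ _ (g1 + (b2 + g2))%Z (- g2 + (b1 + g1))%Z) ]; try lia;
    unfold V, spin_re, spin_im, spinor_config, spinor_disk, null_minus, e1, e2;
    cbn [vx vy va vc];
    repeat (rewrite minus_IZR || rewrite plus_IZR || rewrite opp_IZR); ring. }
  destruct (Nat.lt_ge_cases i j); [now apply O |].
  apply gauss_spin_sym, O; try assumption; lia.
Qed.

(** Each sum is a squared modulus, given by the combinations that serve as spinors, with [xi] and
    [eta] in place of [be] and [ga]. *)
Lemma spinor_config_cocurv (b1 b2 g1 g2 p1 p2 q1 q2 : R) (i j : nat) :
  (i < 4)%nat -> (j < 4)%nat -> i <> j ->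
  let V := spinor_config b1 b2 g1 g2 p1 p2 q1 q2 in 0 <= vc (V i) + vc (V j).
Proof.
  intros Hi Hj Hij V.
  assert (P : forall s t, 0 <= s ^ 2 + t ^ 2) by (intros; nra).
  assert (O : forall i j, (i < 4)%nat -> (j < 4)%nat -> (i < j)%nat -> 0 <= vc (V i) + vc (V j)).
  { clear i j Hi Hj Hij. intros i j Hi Hj Hij.
    set (x1 := b1 - 2 * p2). set (x2 := b2 + 2 * p1).
    set (h1 := g1 + 2 * q2). set (h2 := g2 - 2 * q1).
    case4 i Hi; case4 j Hj; try lia;
      [ pose proof (P x1 x2) as H | pose proof (P h1 h2) as H | pose proof (P (x1 + h1) (x2 + h2)) as H
      | pose proof (P (x1 - h2) (x2 + h1)) as H
      | pose proof (P (x1 - (x2 + h2)) (x2 + (x1 + h1))) as H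
      | pose proof (P (h1 + (x2 + h2)) (h2 - (x1 + h1))) as H ];
    unfold x1, x2, h1, h2 in H; unfold V, spinor_config, spinor_disk, null_minus; cbn [vc]; lra. }
  destruct (Nat.lt_ge_cases i j); [now apply O |].
  rewrite Rplus_comm. apply O; try assumption; lia.
Qed.

Lemma gaussian_config_exists (a0 a1 a2 a3 : Z) :
  (2 * (a0 * a0 + a1 * a1 + a2 * a2 + a3 * a3) = (a0 + a1 + a2 + a3) * (a0 + a1 + a2 + a3))%Z ->
  Z.gcd (Z.gcd a0 a1) (Z.gcd a2 a3) = 1%Z -> (0 <= a0 + a1)%Z -> (0 <= a0 + a2)%Z ->
  exists V, gaussian_config V /\
    va (V 0%nat) = IZR a0 /\ va (V 1%nat) = IZR a1 /\ va (V 2%nat) = IZR a2 /\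
    va (V 3%nat) = IZR a3 /\
    forall i j, (i < 4)%nat -> (j < 4)%nat -> i <> j -> 0 <= vc (V i) + vc (V j).
Proof.
  intros HD HG H1 H2.
  assert (Hm : exists m, (a3 = a0 + a1 + a2 + 2 * m)%Z).
  (* The square of the sum is even by the circle theorem, hence so is the sum. *)
  { destruct (Z.Even_or_Odd (a0 + a1 + a2 + a3)) as [[k Hk] | [k Hk]].
    - exists (k - a0 - a1 - a2)%Z. lia.
    - rewrite Hk in HD. lia. }
  destruct Hm as [m Hm].
  assert (HP : ((a0 + a2) * (a0 + a1) = m * m + a0 * a0)%Z) by (rewrite Hm in HD; lia).
  destruct (rank_one_of_det _ _ _ _ H2 H1 HP)
    as (k & g1 & g2 & b1 & b2 & p1 & p2 & q1 & q2 & Hk & EP & ER & Em & EA & B1 & B2).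
  assert (k = 1)%Z.
  { assert (D0 : (k | a0)%Z) by (rewrite EA; apply Z.divide_factor_l).
    assert (Dm : (k | m)%Z) by (rewrite Em; apply Z.divide_factor_l).
    assert (D1 : (k | a1)%Z).
    { replace a1 with (a0 + a1 - a0)%Z by ring. apply Z.divide_sub_r; [| assumption].
      rewrite ER. apply Z.divide_factor_l. }
    assert (D2 : (k | a2)%Z).
    { replace a2 with (a0 + a2 - a0)%Z by ring. apply Z.divide_sub_r; [| assumption].
      rewrite EP. apply Z.divide_factor_l. }
    assert (D3 : (k | a3)%Z)
      by (rewrite Hm; repeat apply Z.divide_add_r; try assumption; now apply Z.divide_mul_r).
    assert (D : (k | 1)%Z) by (rewrite <- HG; repeat apply Z.gcd_greatest; assumption).
    apply Z.divide_1_r_nonneg in D; assumption. }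
  subst k. rewrite Z.mul_1_l in *.
  exists (spinor_config (IZR b1) (IZR b2) (IZR g1) (IZR g2) (IZR p1) (IZR p2) (IZR q1) (IZR q2)).
  split; [split; [| split] |].
  - apply spinor_config_gram; rewrite <- ?mult_IZR, <- ?minus_IZR, <- ?plus_IZR, <- ?minus_IZR,
      <- ?plus_IZR, <- ?minus_IZR; now f_equal.
  - intros i Hi. now apply spinor_config_lattice.
  - intros i j Hi Hj Hij. now apply spinor_config_spin.
  (* Tangent curvatures add up to squared moduli of spinors; the one for [a3] uses that [m] is the
     real part of the off-diagonal entry. *)
  - assert (E1 : a1 = (b1 * b1 + b2 * b2 - a0)%Z) by lia.
    assert (E2 : a2 = (g1 * g1 + g2 * g2 - a0)%Z) by lia.
    assert (E3 : a3 = ((b1 + g1) * (b1 + g1) + (b2 + g2) * (b2 + g2) - a0)%Z) by lia.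
    repeat split; unfold spinor_config, null_minus, spinor_disk; cbn [va];
      [ rewrite EA | rewrite E1, EA | rewrite E2, EA | rewrite E3, EA
      | intros; now apply spinor_config_cocurv ];
      repeat (rewrite minus_IZR || rewrite plus_IZR || rewrite mult_IZR); ring.
Qed.

(** * The packing *)

Lemma descartes_gram (Q : config) : descartes Q -> gram (fun i => symbol (Q i)).
Proof.
  intros [W T] i j Hi Hj. destruct (Nat.eq_dec i j) as [-> | N].
  - rewrite Nat.eqb_refl. auto using form_symbol_self.
  - rewrite (proj2 (Nat.eqb_neq i j) N). apply tangent_form; auto. now apply T.
Qed.

(** Parseval for the null vector whose product with each [V i] is [- va (V i) / 2]. *)
Lemma descartes_circle_theorem (V : nat -> vec) :
  gram V -> 2 * sum4 (fun i => va (V i) * va (V i)) = sum4 (fun i => va (V i)) ^ 2.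
Proof.
  intros G. pose proof (gram_parseval V (Vec 0 0 0 1) (Vec 0 0 0 1) G) as P.
  unfold form, sum4 in *; cbn [vx vy va vc] in P. lra.
Qed.

(** By [conjugate_symbol] a Descartes conjugate has the old symbol or the moved one, and
    [symbol_inj] excludes the old one. *)
Lemma reachable_orbit (Q0 Q : config) :
  (forall i, (i < 4)%nat -> wf_disk (Q0 i)) -> gaussian_config (fun i => symbol (Q0 i)) ->
  reachable Q0 Q ->
  (forall i, (i < 4)%nat -> wf_disk (Q i)) /\
  orbit (fun i => symbol (Q0 i)) (fun i => symbol (Q i)).
Proof.
  intros W0 GC H. induction H as [| Q i D _ [W O] Hi (WD & ND & T)].
  - split; [assumption | constructor].
  - split.
    + intros j Hj. unfold replace. destruct (Nat.eqb j i); auto.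
    + assert (G : gram (fun i => symbol (Q i))) by (now apply (gaussian_config_orbit _ _ GC O)).
      destruct (conjugate_symbol _ i (symbol D) G Hi) as [E | E].
      * now apply form_symbol_self.
      * intros j Hj N. apply tangent_form; auto. now apply T.
      * now apply symbol_inj in E; auto.
      * replace (fun j => symbol (replace Q i D j)) with (move i (fun j => symbol (Q j)));
          [now constructor |].
        apply functional_extensionality; intros j. unfold replace.
        destruct (Nat.eqb_spec j i) as [-> | N]; [now symmetry |].
        now rewrite move_other.
Qed.

Theorem mainTheorem1 (Q : config) (a0 a1 a2 a3 : Z) :
  descartes Q ->
  curv (Q 0%nat) = IZR a0 -> curv (Q 1%nat) = IZR a1 ->
  curv (Q 2%nat) = IZR a2 -> curv (Q 3%nat) = IZR a3 ->
  Z.gcd (Z.gcd a0 a1) (Z.gcd a2 a3) = 1%Z ->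
  exists Q' : config,
    descartes Q' /\
    (forall i, (i < 4)%nat -> curv (Q' i) = curv (Q i)) /\
    (forall A, in_packing Q' A -> integral_symbol A) /\
    (forall A B, in_packing Q' A -> in_packing Q' B -> tangent A B ->
       spin_gaussian A B) /\
    (forall A, in_packing Q' A ->
       is_int ((curv A - cocurv A) / 2) /\ is_int ((curv A + cocurv A) / 2)).
Proof.
  intros HQ C0 C1 C2 C3 HG.
  assert (Comp : forall i j, (i < 4)%nat -> (j < 4)%nat -> i <> j -> curv_compatible (Q i) (Q j)).
  { destruct HQ as [W T]. intros i j Hi Hj N. apply tangent_form; auto. now apply T. }
  assert (HD : (2 * (a0 * a0 + a1 * a1 + a2 * a2 + a3 * a3)
                = (a0 + a1 + a2 + a3) * (a0 + a1 + a2 + a3))%Z).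
  { pose proof (descartes_circle_theorem _ (descartes_gram Q HQ)) as P.
    unfold sum4 in P; cbn [symbol va] in P. rewrite C0, C1, C2, C3 in P.
    apply eq_IZR. rewrite !mult_IZR, !plus_IZR, !mult_IZR. lra. }
  assert (S : forall i j, curv_compatible (Q i) (Q j) -> 0 <= curv (Q i) + curv (Q j))
    by (intros i j [H | H]; lra).
  assert (P1 : (0 <= a0 + a1)%Z).
  { apply le_IZR. rewrite plus_IZR, <- C0, <- C1. apply S, Comp; lia. }
  assert (P2 : (0 <= a0 + a2)%Z).
  { apply le_IZR. rewrite plus_IZR, <- C0, <- C2. apply S, Comp; lia. }
  destruct (gaussian_config_exists a0 a1 a2 a3 HD HG P1 P2)
    as (V & GV & V0 & V1 & V2 & V3 & Co).
  set (Q' := fun i => disk_of (V i)).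
  assert (DV : forall i, (i < 4)%nat -> wf_disk (Q' i) /\ symbol (Q' i) = V i).
  { intros i Hi. apply disk_of_symbol. now rewrite (proj1 GV), Nat.eqb_refl. }
  assert (Cv : forall i, (i < 4)%nat -> curv (Q' i) = curv (Q i)).
  { intros i Hi. change (va (symbol (Q' i)) = curv (Q i)). rewrite (proj2 (DV i Hi)).
    case4 i Hi; congruence. }
  assert (GQ : gaussian_config (fun i => symbol (Q' i))).
  { destruct GV as (G & L & Sp). split; [| split].
    - intros i j Hi Hj. rewrite !(fun i Hi => proj2 (DV i Hi)) by assumption. auto.
    - intros i Hi. rewrite (proj2 (DV i Hi)). auto.
    - intros i j Hi Hj N. rewrite !(fun i Hi => proj2 (DV i Hi)) by assumption. auto. }
  assert (WQ : forall i, (i < 4)%nat -> wf_disk (Q' i)) by (intros i Hi; now apply DV).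
  assert (Pack : forall A, in_packing Q' A -> exists W i, wf_disk A /\ (i < 4)%nat /\ symbol A = W i /\
    orbit (fun i => symbol (Q' i)) W).
  { intros A (Q1 & i & R1 & Hi & ->). destruct (reachable_orbit _ _ WQ GQ R1) as [W O].
    exists (fun i => symbol (Q1 i)), i. auto. }
  assert (Lat : forall A, in_packing Q' A -> lattice (symbol A)).
  { intros A HA. destruct (Pack A HA) as (W & i & _ & Hi & -> & O).
    now apply (gaussian_config_orbit _ _ GQ O). }
  assert (Tan : forall i j, (i < 4)%nat -> (j < 4)%nat -> i <> j -> tangent (Q' i) (Q' j)).
  { intros i j Hi Hj N. apply form_tangent; auto.
    - rewrite (proj1 GQ) by assumption. now rewrite (proj2 (Nat.eqb_neq i j) N).
    (* The sign condition involves only curvatures, so it is inherited from [Q]. *)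
    - unfold curv_compatible. rewrite !Cv by assumption. now apply Comp.
    - change (0 <= vc (symbol (Q' i)) + vc (symbol (Q' j))).
      rewrite !(fun i Hi => proj2 (DV i Hi)) by assumption. auto. }
  exists Q'. split; [| split; [assumption | split; [| split]]].
  - split; [assumption |]. intros i j Hi Hj N. split; auto using tangent_disjoint.
  - intros A HA. destruct (Lat A HA) as (x & y & z & t & E).
    injection E as E1 E2 E3 E4. unfold integral_symbol. rewrite E1, E2, E3, E4.
    repeat split; [exists x | exists y | exists (t + z)%Z | exists (t - z)%Z];
      now rewrite ?plus_IZR, ?minus_IZR.
  - intros A B HA HB T.
    destruct (Pack A HA) as (W & i & WA & Hi & EA & OA).
    destruct (Pack B HB) as (W' & j & WB & Hj & EB & OB).
    destruct (tangent_form A B WA WB T) as [F _].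
    (* A configuration containing [B] is joined to one containing [A] by going back to the initial
       configuration. *)
    assert (TB : tree (symbol B) W).
    { apply tree_orbit with W'.
      - apply tree_root with j; auto. now apply (gaussian_config_orbit _ _ GQ).
      - apply orbit_trans with (fun i => symbol (Q' i)); [now apply orbit_sym | assumption]. }
    rewrite EA in F. pose proof (tree_spin _ _ _ TB Hi F) as Sp. now rewrite <- EA in Sp.
  - intros A HA. destruct (Lat A HA) as (x & y & z & t & E).
    injection E as _ _ E3 E4. rewrite E3, E4. split; [exists z | exists t]; field.
Qed.
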